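(* For each of the following eleven choices of $(a,b,c)$, $\phi(x)$ and $\lambda$: - #2: $(\tfrac12,\tfrac12,2)$, $\phi=\frac{4x}{(1-x)^2}$, $\lambda=4$; - #3: $(\tfrac16,\tfrac23,\tfrac32)$, $\phi=\frac{27x}{(1-4x)^3}$, $\lambda=1$; - #4: $(\tfrac13,\tfrac13,1)$, $\phi=\frac{27x}{(1-4x)^3}$, $\lambda=1$; - #5: $(\tfrac16,\tfrac12,\tfrac12)$, $\phi=\frac{27x}{(1-4x)^3}$, $\lambda=1$; - #9: $(\tfrac14,\tfrac34,\tfrac12)$, $\phi=\frac{4x}{(1-x)^2}$, $\lambda=1$; - #10: $(\tfrac13,\tfrac23,\tfrac32)$, $\phi=\frac{27x}{(1-4x)^3}$, $\lambda=1$; - #11: $(\tfrac14,\tfrac34,\tfrac32)$, $\phi=\frac{27x}{(1-4x)^3}$, $\lambda=4$; - #12: $(\tfrac13,\tfrac23,1)$, $\phi=\frac{27x}{(1-4x)^3}$, $\lambda=1$; - #13: $(\tfrac13,\tfrac12,\tfrac12)$, $\phi=\frac{27x}{(1-4x)^3}$, $\lambda=1$; - #14: $(\tfrac23,\tfrac23,1)$, $\phi=\frac{27x}{(1-4x)^3}$, $\lambda=1$; - #15: $(\tfrac12,\tfrac12,1)$, $\phi=4x(1-x)$, $\lambda=4$; the generating function $$A(x)={}_2F_1(a,b;c;\phi(\lambda x))^2$$ is obtained from a rank-$2$ Gauss hypergeometric object by taking $\operatorname{Sym}^2$ and then applying the rational pullback $z=\phi(\lambda x)$. More precisely: - rows #5,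 #13 admit annihilating operators of order $1$; - rows #9, #11 admit annihilating operators of order at most $2$; - rows #2, #3, #4, #10, #12, #14, #15 admit annihilating operators of order at most $3$. Thus the eleven rows fall into three classes: binomial collapse (#5, #13), quadratic algebraic (#9, #11), and order-$3$ pullback cases (the remaining seven).
   Context: Each $A(x)$ is a formal power series in $x$ over $\mathbb{Q}$ (note $\phi(0)=0$). An annihilating operator is a nonzero linear differential operator in $\frac{d}{dx}$ with coefficients in $\mathbb{Q}(x)$ that annihilates $A(x)$. The first assertion means that $A=f^2$ with $f(x)={}_2F_1(a,b;c;\phi(\lambda x))$, so $A$ lies in the symmetric square of the (at most) rank-$2$ differential module over $\mathbb{Q}(x)$ generated by $f$, i.e. in the pullback along $z=\phi(\lambda x)$ of the symmetric square of the Gauss hypergeometric module of ${}_2F_1(a,b;c;z)$. *)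

(* Defs.v *)
From HB Require Import structures.
From mathcomp Require Import all_boot all_order all_algebra generic_quotient boolp ring.

Set Implicit Arguments.
Unset Strict Implicit.
Unset Printing Implicit Defensive.

Import GRing.Theory.
Local Open Scope ring_scope.
Local Open Scope quotient_scope.

Notation "x %:F" := (@FracField.tofrac _ x) : ring_scope.

(* -------------------------------------------------------------------------- *)
(** * The ring R[[x]] of formal power series *)

Record fps (R : Type) := Fps { coefs :> nat -> R }.

HB.instance Definition _ (R : Type) := gen_eqMixin (fps R).
HB.instance Definition _ (R : Type) := gen_choiceMixin (fps R).

Lemma fpsP (R : Type) (a b : fps R) : (forall n, a n = b n) <-> a = b.
Proof. by split=> [|->//]; case: a b => a [b] /= /funext ->. Qed.

Section FpsRing.
Variable R : comNzRingType.
Implicit Types a b c : fps R.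

Definition fps_add a b := Fps (fun n => a n + b n).
Definition fps_opp a := Fps (fun n => - a n).
Definition fps_const (c : R) := Fps (fun n => if n is 0 then c else 0).
Definition fps_mul a b := Fps (fun n => \sum_(i < n.+1) a i * b (n - i)%N).

Fact fps_addA : associative fps_add.
Proof. by move=> a b c; apply/fpsP => n /=; rewrite addrA. Qed.
Fact fps_addC : commutative fps_add.
Proof. by move=> a b; apply/fpsP => n /=; rewrite addrC. Qed.
Fact fps_add0 : left_id (Fps (fun=> 0)) fps_add.
Proof. by move=> a; apply/fpsP => n /=; rewrite add0r. Qed.
Fact fps_addN : left_inverse (Fps (fun=> 0)) fps_opp fps_add.
Proof. by move=> a; apply/fpsP => n /=; rewrite addNr. Qed.

HB.instance Definition _ :=
  GRing.isZmodule.Build (fps R) fps_addA fps_addC fps_add0 fps_addN.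

Definition fps_trunc N a : {poly R} := \poly_(i < N.+1) a i.

Lemma fps_mul_trunc N a b n : (n <= N)%N ->
  fps_mul a b n = (fps_trunc N a * fps_trunc N b)`_n.
Proof.
move=> le_nN; rewrite coefM; apply: eq_bigr => i _.
by rewrite !coef_poly !ltnS (leq_trans (leq_subr _ _) le_nN)
  (leq_trans (leq_ord i) le_nN).
Qed.

Fact fps_mulC : commutative fps_mul.
Proof.
by move=> a b; apply/fpsP => n; rewrite !(fps_mul_trunc _ _ (leqnn n)) mulrC.
Qed.

Fact fps_mulA : associative fps_mul.
Proof.
move=> a b c; apply/fpsP => n.
have eL : fps_mul a (fps_mul b c) n
        = (fps_trunc n a * (fps_trunc n b * fps_trunc n c))`_n.
  rewrite coefM; apply: eq_bigr => i _.
  rewrite coef_poly ltn_ord; congr (_ * _).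
  by rewrite (@fps_mul_trunc n) ?leq_subr.
have eR : fps_mul (fps_mul a b) c n
        = (fps_trunc n a * fps_trunc n b * fps_trunc n c)`_n.
  rewrite coefM; apply: eq_bigr => i _.
  rewrite [(fps_trunc n c)`_ _]coef_poly ltnS leq_subr; congr (_ * _).
  by rewrite (@fps_mul_trunc n) ?leq_ord.
by rewrite eL eR mulrA.
Qed.

Fact fps_mul1 : left_id (fps_const 1) fps_mul.
Proof.
move=> a; apply/fpsP => n /=; rewrite big_ord_recl /= subn0 mul1r.
by rewrite big1 ?addr0 // => i _; rewrite mul0r.
Qed.

Fact fps_mulDl : left_distributive fps_mul fps_add.
Proof.
move=> a b c; apply/fpsP => n /=; rewrite -big_split /=.
by apply: eq_bigr => i _; rewrite mulrDl.
Qed.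

Fact fps_one_neq0 : fps_const 1 != 0.
Proof. by apply/eqP => /fpsP/(_ 0%N)/eqP; rewrite oner_eq0. Qed.

HB.instance Definition _ := GRing.Zmodule_isComNzRing.Build (fps R)
  fps_mulA fps_mulC fps_mul1 fps_mulDl fps_one_neq0.

Definition fps_unit : {pred fps R} := fun a => `[< exists b, b * a = 1 >].
Definition fps_inv a : fps R :=
  if pselect (exists b, b * a = 1) is left ex then projT1 (cid ex) else a.

Fact fps_mulVx : {in fps_unit, left_inverse 1 fps_inv *%R}.
Proof.
move=> a /asboolP ua; rewrite /fps_inv; case: pselect => // ex.
exact: projT2 (cid ex).
Qed.

Fact fps_unitPl a b : b * a = 1 -> fps_unit a.
Proof. by move=> ba1; apply/asboolP; exists b. Qed.

Fact fps_inv_out : {in [predC fps_unit], fps_inv =1 id}.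
Proof.
move=> a; rewrite inE => /negP ua; rewrite /fps_inv; case: pselect => // ex.
by case: ua; apply/asboolP.
Qed.

HB.instance Definition _ := GRing.ComNzRing_hasMulInverse.Build (fps R)
  fps_mulVx fps_unitPl fps_inv_out.

Lemma fpsME a b n : (a * b) n = \sum_(i < n.+1) a i * b (n - i)%N.
Proof. by []. Qed.

Lemma fps1E n : (1 : fps R) n = (n == 0%N)%:R.
Proof. by case: n. Qed.

Definition fpsX : fps R := Fps (fun n => (n == 1%N)%:R).
Definition fps_of_poly (p : {poly R}) : fps R := Fps (fun n => p`_n).
Definition fps_deriv a : fps R := Fps (fun n => a n.+1 *+ n.+1).

(* Substitution a(b(x)).  The coefficient sum is finite, and is the right one,
   because b ^+ k is divisible by x^k; hence this is meaningful only for
   b 0 = 0. *)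
Definition fps_comp a b : fps R :=
  Fps (fun n => \sum_(k < n.+1) a k * (b ^+ k) n).

Fact fps_of_poly_is_zmod_morphism : zmod_morphism fps_of_poly.
Proof. by move=> p q; apply/fpsP => n /=; rewrite coefB. Qed.
Fact fps_of_poly_is_monoid_morphism : monoid_morphism fps_of_poly.
Proof.
split=> [|p q]; apply/fpsP => n; first by rewrite fps1E /= coef1.
by rewrite /= coefM.
Qed.
HB.instance Definition _ := GRing.isZmodMorphism.Build {poly R} (fps R)
  fps_of_poly fps_of_poly_is_zmod_morphism.
HB.instance Definition _ := GRing.isMonoidMorphism.Build {poly R} (fps R)
  fps_of_poly fps_of_poly_is_monoid_morphism.

Lemma fps_of_poly_inj : injective fps_of_poly.
Proof. by move=> p q /fpsP e; apply/polyP => n; have := e n. Qed.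

Fact fps_deriv_additive : {morph fps_deriv : a b / a + b}.
Proof. by move=> a b; apply/fpsP => n /=; rewrite mulrnDl. Qed.

Fact fps_derivM a b : fps_deriv (a * b) = fps_deriv a * b + a * fps_deriv b.
Proof.
have tD (N : nat) (c : fps R) :
    fps_trunc N (fps_deriv c) = (fps_trunc N.+1 c)^`().
  apply/polyP => i; rewrite coef_deriv !coef_poly !ltnS.
  by case: ifP => // _; rewrite mul0rn.
have tS N i (c d : fps R) : (i <= N)%N ->
    (fps_trunc N c * fps_trunc N.+1 d)`_i = (c * d) i.
  move=> le_iN; rewrite coefM fpsME; apply: eq_bigr => j _.
  have le_jN : (j <= N)%N by rewrite (leq_trans (leq_ord j)).
  by rewrite !coef_poly !ltnS le_jN leqW // (leq_trans (leq_subr _ _)).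
apply/fpsP => n.
have -> : fps_deriv (a * b) n = (fps_trunc n.+1 a * fps_trunc n.+1 b)^`()`_n.
  by rewrite coef_deriv /=; congr (_ *+ _); rewrite -fps_mul_trunc.
rewrite derivM coefD -!tD tS //.
by rewrite [fps_trunc n.+1 a * _]mulrC tS // [_ * a]mulrC.
Qed.
End FpsRing.

Lemma fps_unitE (R : comUnitRingType) (a : fps R) :
  (a \is a GRing.unit) = (a 0%N \is a GRing.unit).
Proof.
apply/idP/idP => [/mulVr/fpsP/(_ 0%N) | u0].
  rewrite fpsME big_ord1 fps1E /= => e.
  by apply/unitrPr; exists (a^-1 0%N); rewrite mulrC e.
pose fix s n := if n is m.+1 then rcons (s m)
  ((a 0%N)^-1 * ((m == 0%N)%:R - \sum_(i < m) (s m)`_i * a (m - i)%N)) else [::].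
have size_s n : size (s n) = n by elim: n => //= n IH; rewrite size_rcons IH.
pose b := Fps (fun n => (s n.+1)`_n).
have s_nth n i : (i < n)%N -> (s n)`_i = b i.
  elim: n => // n IH; rewrite ltnS leq_eqVlt => /orP[/eqP->//|lt_in].
  by rewrite /= nth_rcons size_s lt_in IH.
have bE n : b n = (a 0%N)^-1 * ((n == 0%N)%:R - \sum_(i < n) b i * a (n - i)%N).
  rewrite {1}/b /= nth_rcons size_s ltnn eqxx; congr (_ * (_ - _)).
  by apply: eq_bigr => i _; rewrite s_nth.
apply/unitrPr; exists b; rewrite mulrC; apply/fpsP => n.
rewrite fpsME fps1E big_ord_recr [(ord_max : nat)]/= subnn bE.
rewrite mulrAC mulVr // mul1r; apply: etrans (addrC _ _) (subrK _ _).
Qed.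

Fact fps_integral (R : idomainType) (a b : fps R) :
  a * b = 0 -> (a == 0) || (b == 0).
Proof.
move=> ab0; apply: contraT; rewrite negb_or => /andP[a0 b0].
have nz (c : fps R) : c != 0 ->
    exists2 i, c i != 0 & forall j, (j < i)%N -> c j = 0.
  move=> c0; have ex : exists i, c i != 0.
    apply/not_existsP => H; case/eqP: c0; apply/fpsP => i.
    by apply/eqP; apply/negPn/negP => /H.
  case: (ex_minnP ex) => i ci mi; exists i => // j lt_ji.
  by apply/eqP; apply: contraTT lt_ji => /mi; rewrite -leqNgt.
have [i ai mi] := nz a a0; have [j bj mj] := nz b b0.
have /fpsP/(_ (i + j)%N) := ab0.
have lt_i : (i < (i + j).+1)%N by rewrite ltnS leq_addr.
rewrite fpsME (bigD1 (Ordinal lt_i)) //= addKn big1 ?addr0.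
  by move=> /eqP; rewrite mulf_eq0 (negPf ai) (negPf bj).
move=> k ne_ki; case: (ltngtP k i) => [/mi->|lt_ik|e]; first by rewrite mul0r.
  have lt_kj : (i + j - k < j)%N.
    by rewrite ltn_subLR ?ltn_add2r // -ltnS ltn_ord.
  by rewrite (mj _ lt_kj) mulr0.
by case/eqP: ne_ki; apply: val_inj.
Qed.

HB.instance Definition _ (R : idomainType) :=
  GRing.ComUnitRing_isIntegral.Build (fps R) (@fps_integral R).

(* -------------------------------------------------------------------------- *)
(** * Fields of fractions *)

Lemma frac_reprE (R : idomainType) (u : {fraction R}) :
  u = (\n_(repr u))%:F / (\d_(repr u))%:F.
Proof.
have d0 : (\d_(repr u))%:F != 0 by rewrite tofrac_eq0 denom_ratioP.
apply: (canRL (mulfK d0)); rewrite -{1}[u]reprK.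
case: (repr u) d0 => [[n d] /= d_neq0] _.
unfold FracField.tofrac; unlock; rewrite -[LHS]FracField.pi_mul.
apply/eqmodP; rewrite /= FracField.equivfE /FracField.mulf.
by rewrite !numden_Ratio ?(oner_eq0, mulf_neq0, denom_ratioP) //= ?mulr1 mulrC.
Qed.

Lemma frac_repr (R : idomainType) (n m : R) : m != 0 ->
  n * \d_(repr (n%:F / m%:F)) = \n_(repr (n%:F / m%:F)) * m.
Proof.
move=> m0; set u := _ / _; have := frac_reprE u; rewrite [in LHS]/u.
move=> /eqP; rewrite eqr_div ?tofrac_eq0 ?denom_ratioP //.
by rewrite -!tofracM tofrac_eq => /eqP.
Qed.

(* In frac_map and frac_deriv, \n_r / \d_r is some representative of u;
   frac_mapE and frac_derivE show that the choice is immaterial. *)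
Definition frac_map (R S : idomainType) (f : R -> S) (u : {fraction R}) :
    {fraction S} :=
  let r := repr u in (f \n_r)%:F / (f \d_r)%:F.

Definition frac_deriv (R : idomainType) (d : R -> R) (u : {fraction R}) :
    {fraction R} :=
  let r := repr u in (d \n_r * \d_r - \n_r * d \d_r)%:F / (\d_r ^+ 2)%:F.

Lemma frac_mapE (R S : idomainType) (f : {rmorphism R -> S}) (n m : R) :
  injective f -> m != 0 -> frac_map f (n%:F / m%:F) = (f n)%:F / (f m)%:F.
Proof.
move=> f_inj m0; have := frac_repr n m0; rewrite /frac_map.
set r := repr _ => e; have nz x : x != 0 -> (f x)%:F != 0.
  by rewrite tofrac_eq0 -(inj_eq f_inj) rmorph0.
apply/eqP; rewrite eqr_div ?nz ?denom_ratioP // -!tofracM -!rmorphM.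
by rewrite [n * _]e.
Qed.

Lemma frac_derivE (R : idomainType) (d : R -> R) (n m : R) :
  (forall x y, d (x * y) = d x * y + x * d y) -> m != 0 ->
  frac_deriv d (n%:F / m%:F) = (d n * m - n * d m)%:F / (m ^+ 2)%:F.
Proof.
move=> dM m0; have := frac_repr n m0; rewrite /frac_deriv.
set r := repr _ => e; have := congr1 d e; rewrite !dM => e'.
apply/eqP; rewrite eqr_div ?tofrac_eq0 ?expf_neq0 ?denom_ratioP //.
rewrite -!tofracM tofrac_eq; apply/eqP.
apply: etrans (_ : m * \d_r * (d n * \d_r + n * d \d_r - n * d \d_r)
                   - (n * \d_r) * (d m * \d_r) = _); last by ring.
by rewrite e' e; ring: e.
Qed.

(* -------------------------------------------------------------------------- *)
(** * The differential fields Q(x) and Q((x)) *)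

Notation Qx := {fraction {poly rat}}.
Notation Laurent := {fraction (fps rat)}.

Definition ratX : Qx := 'X%:F.
Definition ratC (c : rat) : Qx := c%:P%:F.

Definition derQ : Qx -> Qx := frac_deriv (@deriv rat).
Definition derL : Laurent -> Laurent := frac_deriv (@fps_deriv rat).

(* the expansion at 0, embedding Q(x) into Q((x)) *)
Definition iota : Qx -> Laurent := frac_map (@fps_of_poly rat).

(* Substitution r(g(x)), meaningful as soon as g is not a pole of r (for
   instance when g is not constant). *)
Definition ratcomp (r g : Qx) : Qx :=
  (map_poly ratC \n_(repr r)).[g] / (map_poly ratC \d_(repr r)).[g].

(* A linear differential operator \sum_i L_i (d/dx)^i is represented by the
   polynomial L that lists its coefficients; only the additive structure of
   {poly Qx} is relevant.  The order of L != 0 is thus (size L).-1. *)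
Definition diffop_app (L : {poly Qx}) (u : Laurent) : Laurent :=
  \sum_(i < size L) iota L`_i * iter i derL u.

Definition annihilated_order (n : nat) (u : Laurent) : Prop :=
  exists L : {poly Qx}, [/\ L != 0, size L = n.+1 & diffop_app L u = 0].

Definition annihilated_order_le (n : nat) (u : Laurent) : Prop :=
  exists L : {poly Qx},
    [/\ L != 0, (size L <= n.+1)%N & diffop_app L u = 0].

Definition quadratic_algebraic (u : Laurent) : Prop :=
  exists P : {poly Qx},
    [/\ irreducible_poly P, size P = 3 & (map_poly iota P).[u] = 0].

(* -------------------------------------------------------------------------- *)
(** * Differential modules over Q(x) *)

(* A differential module of rank n with basis e_0, .., e_(n-1) is given by the
   matrix C of its connection: \partial e_i = \sum_j C i j e_j.  An element
   \sum_i v_i e_i is represented by the row vector v. *)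

Definition mx_of_rows n (rows : seq (seq Qx)) : 'M[Qx]_n :=
  \matrix_(i, j) nth 0 (nth [::] rows i) j.

Definition conn n (C : 'M[Qx]_n) (v : 'rV[Qx]_n) : 'rV[Qx]_n :=
  map_mx derQ v + v *m C.

(* pullback along z = g(x), by the chain rule *)
Definition pullback (g : Qx) n (C : 'M[Qx]_n) : 'M[Qx]_n :=
  derQ g *: map_mx (ratcomp ^~ g) C.

(* the symmetric square of a module of rank 2,
   in the basis e_0 e_0, e_0 e_1, e_1 e_1 *)
Definition sym2 (C : 'M[Qx]_2) : 'M[Qx]_3 :=
  let: (p, q, r, s) := (C 0 0, C 0 1, C 1 0, C 1 1) in
  mx_of_rows 3 [:: [:: 2%:R * p; 2%:R * q; 0        ];
                   [:: r       ; p + s   ; q        ];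
                   [:: 0       ; 2%:R * r; 2%:R * s ]].

(* The Gauss module: e_0 stands for a solution of
   z (1 - z) y'' + (c - (a + b + 1) z) y' - a b y = 0, and e_1 = \partial e_0. *)
Definition gauss (a b c : rat) : 'M[Qx]_2 :=
  let z := ratX in
  mx_of_rows 2
    [:: [:: 0; 1];
        [:: ratC (a * b) / (z * (1 - z));
            - (ratC c - ratC (a + b + 1) * z) / (z * (1 - z)) ]].

(* the Q(x)-linear map to Q((x)) sending e_i to h_i *)
Definition lin_eval n (h : 'cV[Laurent]_n) (v : 'rV[Qx]_n) : Laurent :=
  (map_mx iota v *m h) 0 0.

Definition horizontal n (C : 'M[Qx]_n) (h : 'cV[Laurent]_n) : Prop :=
  forall v, derL (lin_eval h v) = lin_eval h (conn C v).

(* the map induced by h on the symmetric square, e_i e_j |-> h_i h_j *)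
Definition sym2_vec (h : 'cV[Laurent]_2) : 'cV[Laurent]_3 :=
  let: (h0, h1) := (h 0 0, h 1 0) in
  \col_i nth 0 [:: h0 ^+ 2; h0 * h1; h1 ^+ 2] i.

(* the differential module over Q(x) generated by u inside Q((x)) *)
Definition diffmod (u : Laurent) : Laurent -> Prop :=
  fun w => exists L : {poly Qx}, w = diffop_app L u.

(* the image in Q((x)) of the symmetric square of M, i.e. the space of finite
   sums of products of two elements of M (which is stable under Q(x) if M is) *)
Definition sym2_image (M : Laurent -> Prop) : Laurent -> Prop :=
  fun w => exists2 s : seq (Laurent * Laurent),
    (forall p, p \in s -> M p.1 /\ M p.2) & w = \sum_(p <- s) p.1 * p.2.

(* [Sym^2 then pullback] w = u^2 is the value of the element e_0 e_0 of the
   pullback along g of the symmetric square of the Gauss module, under the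
   horizontal map induced by a horizontal map h from the pullback of the Gauss
   module onto diffmod u with h(e_0) = u. In particular diffmod u has rank
   at most 2. *)
Definition sym2_pullback_of_gauss (a b c : rat) (g : Qx) (u w : Laurent) :
    Prop :=
  exists h : 'cV[Laurent]_2,
    [/\ horizontal (pullback g (gauss a b c)) h,
        lin_eval h (delta_mx 0 0) = u &
        forall y, diffmod u y <-> exists v, y = lin_eval h v] /\
    [/\ horizontal (pullback g (sym2 (gauss a b c))) (sym2_vec h),
        lin_eval (sym2_vec h) (delta_mx 0 0) = w &
        forall y, sym2_image (diffmod u) y
                  <-> exists v, y = lin_eval (sym2_vec h) v].

(* -------------------------------------------------------------------------- *)
(** * Hypergeometric and binomial series *)

(* the Pochhammer symbol (a)_n *)
Definition pochhammer (a : rat) (n : nat) : rat := \prod_(i < n) (a + i%:R).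

Definition hyp2F1 (a b c : rat) : fps rat :=
  Fps (fun n => pochhammer a n * pochhammer b n / (pochhammer c n * n`!%:R)).

(* (1 + x)^s *)
Definition binomial_series (s : rat) : fps rat :=
  Fps (fun n => (\prod_(i < n) (s - i%:R)) / n`!%:R).

(* -------------------------------------------------------------------------- *)
(** * The eleven rows *)

Inductive table_row :=
  Row2 | Row3 | Row4 | Row5 | Row9 | Row10 | Row11 | Row12 | Row13 | Row14
| Row15.

Definition row_abc (i : table_row) : rat * rat * rat :=
  match i with
  | Row2  => (1 / 2, 1 / 2, 2)
  | Row3  => (1 / 6, 2 / 3, 3 / 2)
  | Row4  => (1 / 3, 1 / 3, 1)
  | Row5  => (1 / 6, 1 / 2, 1 / 2)
  | Row9  => (1 / 4, 3 / 4, 1 / 2)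
  | Row10 => (1 / 3, 2 / 3, 3 / 2)
  | Row11 => (1 / 4, 3 / 4, 3 / 2)
  | Row12 => (1 / 3, 2 / 3, 1)
  | Row13 => (1 / 3, 1 / 2, 1 / 2)
  | Row14 => (2 / 3, 2 / 3, 1)
  | Row15 => (1 / 2, 1 / 2, 1)
  end.

Definition row_a i := (row_abc i).1.1.
Definition row_b i := (row_abc i).1.2.
Definition row_c i := (row_abc i).2.

(* phi is evaluated both in Q(x) and in Q[[x]], where the denominators below
   are units for x 0 = 0 (see fps_unitE). *)
Definition row_phi (i : table_row) (R : comUnitRingType) (x : R) : R :=
  match i with
  | Row2 | Row9 => 4 * x / (1 - x) ^+ 2
  | Row3 | Row4 | Row5 | Row10 | Row11 | Row12 | Row13 | Row14 =>
      27 * x / (1 - 4 * x) ^+ 3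
  | Row15 => 4 * x * (1 - x)
  end.

Definition row_lambda (i : table_row) : nat :=
  match i with
  | Row2 | Row11 | Row15 => 4
  | Row3 | Row4 | Row5 | Row9 | Row10 | Row12 | Row13 | Row14 => 1
  end.

(* phi(lambda x), as a rational function and as a power series *)
Definition phi_rat (i : table_row) : Qx := row_phi i (ratX *+ row_lambda i).
Definition phi_fps (i : table_row) : fps rat := row_phi i (fpsX rat *+ row_lambda i).

Lemma phi_fps0 i : phi_fps i 0%N = 0.
Proof.
have M0 (u v : fps rat) : (u * v) 0%N = u 0%N * v 0%N.
  by rewrite fpsME big_ord1.
have X0 n : (fpsX rat *+ n) 0%N = 0.
  by rewrite -mulr_natl M0 mulr0.
by case: i; rewrite /phi_fps /row_phi !M0 X0 ?mulr0 ?mul0r.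
Qed.

(* f(x) = 2F1(a, b; c; phi(lambda x)) *)
Definition row_f (i : table_row) : fps rat :=
  fps_comp (hyp2F1 (row_a i) (row_b i) (row_c i)) (phi_fps i).

Definition row_A (i : table_row) : fps rat := row_f i ^+ 2.

(* (1 - phi(lambda x))^s *)
Definition one_minus_phi_pow (i : table_row) (s : rat) : fps rat :=
  fps_comp (binomial_series s) (- phi_fps i).

(* Main.v *)
From HB Require Import structures.
From mathcomp Require Import all_boot all_order all_algebra ring.
Require Import Defs.

Set Implicit Arguments.
Unset Strict Implicit.
Unset Printing Implicit Defensive.

Import Order.TTheory GRing.Theory Num.Theory.
Local Open Scope ring_scope.

(** Everything rests on one solution of one linear system. Let F be the
    hypergeometric series of parameters a, b, c and let phi be a nonzero power
    series without constant term that expands a rational function g. Comparing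
    coefficients, F solves the Gauss equation (hyp2F1_ode); by the chain rule,
    the pair of composites of F and F' with phi then solves the pullback along g
    of the Gauss system (gauss_solution_horizontal). Its first entry f generates
    the module because g' is not 0 (diffmod_cyclic), and by the Leibniz rule the
    three products of the two entries solve the symmetric square of the pulled
    back system (sym2_horizontal). Symmetric square and pullback commute as soon
    as substituting g is a field morphism, that is, as soon as g is
    transcendental over Q. It is: a nonzero polynomial is x^m q with q(0) not 0,
    so its value at phi is phi^m times a series of constant term q(0)
    (pullback_transcendental).

    Order at most 3 follows from rank 3: in a module of rank n the n + 1 vectors
    v, v', ..., v^(n) are dependent, and a horizontal map turns the dependence
    into an annihilating operator (horizontal_annihilated).

    The other two classes need closed forms. When b = c, the Gauss recurrence
    loses a factor and F = (1 - z)^(-a), so A is a power of 1 - phi, which has a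
    rational logarithmic derivative. When {a, b} = {1/4, 3/4}, put z = s^2: then
    F is the even part of (1 + s)^(-1/2) if c = 1/2, and s F is twice the odd part
    of (1 + s)^(1/2) if c = 3/2. Squaring and using (1 + s)(1 - s) = 1 - z gives
    2 (1 - z) F^2 = 1 + sqrt (1 - z), respectively z F^2 = 2 - 2 sqrt (1 - z).
    So A lies in the rank 2 module spanned by 1 and sqrt (1 - phi), which yields
    order at most 2; and A is quadratic and not rational because 1 - phi takes a
    negative value at some rational point, hence is not a square in Q(x)
    (not_square).

    Identities between powers U^s of power series are all obtained from the
    uniqueness of the solution of U y' = s U' y with y(0) = 1. *)

(** * Fraction fields *)

Lemma frac_ind (R : idomainType) (P : {fraction R} -> Prop) :
  (forall n m, m != 0 -> P (n%:F / m%:F)) -> forall u, P u.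
Proof. by move=> H u; rewrite (frac_reprE u); apply/H/denom_ratioP. Qed.

Lemma frac_addE (R : idomainType) (n m p q : R) : m != 0 -> q != 0 ->
  n%:F / m%:F + p%:F / q%:F = (n * q + p * m)%:F / (m * q)%:F.
Proof.
by move=> m0 q0; rewrite addf_div ?tofrac_eq0 // rmorphD !rmorphM.
Qed.

Lemma frac_mulE (R : idomainType) (n m p q : R) :
  (n%:F / m%:F) * (p%:F / q%:F) = (n * p)%:F / (m * q)%:F.
Proof. by rewrite mulf_div !rmorphM. Qed.

Section FracMap.
Variables (R S : idomainType) (f : {rmorphism R -> S}).
Hypothesis f_inj : injective f.

Lemma frac_map_tofrac x : frac_map f x%:F = (f x)%:F.
Proof.
by rewrite -[x%:F]divr1 -(rmorph1 (@FracField.tofrac R)) frac_mapE ?oner_eq0 //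
  !rmorph1 divr1.
Qed.

Lemma frac_mapD u v : frac_map f (u + v) = frac_map f u + frac_map f v.
Proof.
elim/frac_ind: u => n m m0; elim/frac_ind: v => p q q0.
have nz x : x != 0 -> f x != 0 by rewrite -(inj_eq f_inj) rmorph0.
by rewrite frac_addE // !frac_mapE ?mulf_neq0 // frac_addE ?nz // !rmorphM rmorphD
  !rmorphM.
Qed.

Lemma frac_map_zmod : zmod_morphism (frac_map f).
Proof.
by move=> u v; apply: (addIr (frac_map f v)); rewrite -frac_mapD !subrK.
Qed.

Lemma frac_map_monoid : monoid_morphism (frac_map f).
Proof.
split=> [|u v]; first by rewrite -[1]/(1%:F) frac_map_tofrac rmorph1.
elim/frac_ind: u => n m m0; elim/frac_ind: v => p q q0.
by rewrite frac_mulE // !frac_mapE ?mulf_neq0 // frac_mulE !rmorphM.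
Qed.
End FracMap.

Section FracDeriv.
Variables (R : idomainType) (d : R -> R).
Hypothesis dD : {morph d : x y / x + y}.
Hypothesis dM : forall x y, d (x * y) = d x * y + x * d y.

Lemma frac_derivD u v :
  frac_deriv d (u + v) = frac_deriv d u + frac_deriv d v.
Proof.
elim/frac_ind: u => n m m0; elim/frac_ind: v => p q q0.
rewrite frac_addE // !frac_derivE ?mulf_neq0 // frac_addE ?expf_neq0 //.
apply/eqP; rewrite eqr_div ?tofrac_eq0 ?mulf_neq0 ?expf_neq0 ?mulf_neq0 //.
by apply/eqP; rewrite -!rmorphM dD !dM; congr (_%:F); ring.
Qed.

Lemma frac_derivM u v :
  frac_deriv d (u * v) = frac_deriv d u * v + u * frac_deriv d v.
Proof.
elim/frac_ind: u => n m m0; elim/frac_ind: v => p q q0.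
rewrite frac_mulE // !frac_derivE ?mulf_neq0 // !frac_mulE.
rewrite frac_addE ?mulf_neq0 ?expf_neq0 //.
apply/eqP; rewrite eqr_div ?tofrac_eq0 ?mulf_neq0 ?expf_neq0 ?mulf_neq0 //.
by apply/eqP; rewrite -!rmorphM !dM; congr (_%:F); ring.
Qed.

Lemma derivation0 : d 0 = 0.
Proof. by apply: (addIr (d 0)); rewrite -dD !add0r. Qed.

Lemma derivation1 : d 1 = 0.
Proof.
by have := dM 1 1; rewrite !mul1r mulr1 => /esym/eqP; rewrite -subr_eq0 addrK => /eqP.
Qed.

Lemma frac_deriv_tofrac x : frac_deriv d x%:F = (d x)%:F.
Proof.
rewrite -[x%:F]divr1 -(rmorph1 (@FracField.tofrac R)) frac_derivE ?oner_eq0 //.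
by rewrite derivation1 mulr0 subr0 mulr1 expr1n rmorph1 divr1.
Qed.
End FracDeriv.

(* Simplification would expose the representatives chosen in these maps. *)
Arguments derQ : simpl never.
Arguments derL : simpl never.
Arguments iota : simpl never.
Arguments ratcomp : simpl never.
Arguments FracField.tofrac : simpl never.

Lemma iota_zmod : zmod_morphism iota.
Proof. exact: (frac_map_zmod (@fps_of_poly_inj rat)). Qed.
Lemma iota_monoid : monoid_morphism iota.
Proof. exact: (frac_map_monoid (@fps_of_poly_inj rat)). Qed.
HB.instance Definition _ := GRing.isZmodMorphism.Build Qx Laurent iota iota_zmod.
HB.instance Definition _ :=
  GRing.isMonoidMorphism.Build Qx Laurent iota iota_monoid.

Lemma iota_poly (p : {poly rat}) : iota p%:F = (fps_of_poly p)%:F.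
Proof. exact: (frac_map_tofrac (@fps_of_poly_inj rat)). Qed.

Lemma derQD u v : derQ (u + v) = derQ u + derQ v.
Proof. exact: (frac_derivD (@derivD rat) (@derivM rat)). Qed.
Lemma derQM u v : derQ (u * v) = derQ u * v + u * derQ v.
Proof. exact: (frac_derivM (@derivM rat)). Qed.
Lemma derLD u v : derL (u + v) = derL u + derL v.
Proof. exact: (frac_derivD (@fps_deriv_additive rat) (@fps_derivM rat)). Qed.
Lemma derLM u v : derL (u * v) = derL u * v + u * derL v.
Proof. exact: (frac_derivM (@fps_derivM rat)). Qed.
Lemma derL_fps (a : fps rat) : derL a%:F = (fps_deriv a)%:F.
Proof. exact: (frac_deriv_tofrac (@fps_derivM rat)). Qed.

Lemma fps_deriv_poly (p : {poly rat}) :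
  fps_deriv (fps_of_poly p) = fps_of_poly p^`().
Proof. by apply/fpsP => n /=; rewrite coef_deriv. Qed.

Lemma derL_iota u : derL (iota u) = iota (derQ u).
Proof.
elim/frac_ind: u => n m m0.
have m0' : fps_of_poly m != 0.
  by rewrite -(inj_eq (@fps_of_poly_inj rat)) rmorph0 in m0 *.
rewrite [derQ _]frac_derivE //; last exact: derivM.
rewrite !fmorph_div /= !iota_poly [derL _]frac_derivE //; last exact: fps_derivM.
by rewrite !fps_deriv_poly -!rmorphM -rmorphB -rmorphXn.
Qed.

(** * Composition of power series *)

Section Composition.
Variable R : comNzRingType.
Implicit Types (a b : fps R) (p : {poly R}).

Lemma fpsDE a b n : (a + b) n = a n + b n. Proof. by []. Qed.
Lemma fpsNE a n : (- a) n = - a n. Proof. by []. Qed.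

Lemma fps_sumE I (s : seq I) (P : pred I) (F : I -> fps R) n :
  (\sum_(i <- s | P i) F i) n = \sum_(i <- s | P i) F i n.
Proof. by apply: (big_morph (fun a : fps R => a n)). Qed.

Lemma fpsM0E a b : (a * b) 0%N = a 0%N * b 0%N.
Proof. by rewrite fpsME big_ord1. Qed.

Lemma fps_constM c a n : (fps_of_poly c%:P * a) n = c * a n.
Proof.
rewrite fpsME big_ord_recl /= subn0 coefC eqxx big1 ?addr0 // => i _.
by rewrite coefC mul0r.
Qed.

Lemma fpsXM a n : (fpsX R * a) n = if n is m.+1 then a m else 0.
Proof.
case: n => [|n]; first by rewrite fpsM0E mul0r.
rewrite fpsME big_ord_recl mul0r add0r big_ord_recl /= subn1 mul1r.
by rewrite big1 ?addr0 // => i _; rewrite mul0r.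
Qed.

Lemma fps_of_polyX : fps_of_poly 'X = fpsX R.
Proof. by apply/fpsP => n /=; rewrite coefX. Qed.

(** This is what makes the coefficient sums of a composite finite. *)
Lemma fps_expr_lt b : b 0%N = 0 -> forall k n, (n < k)%N -> (b ^+ k) n = 0.
Proof.
move=> b0; elim=> // k IH n; rewrite exprS fpsME big_ord_recl b0 mul0r add0r.
move=> lt_nk; apply: big1 => i _; rewrite IH ?mulr0 //= /bump leq0n add1n.
by apply: leq_trans (lt_nk : n <= k)%N; rewrite ltn_subrL (leq_trans _ (ltn_ord i)).
Qed.

Definition fps_eval b p : fps R := (map_poly (@fps_of_poly R \o polyC) p).[b].

Lemma fps_evalM b p q : fps_eval b (p * q) = fps_eval b p * fps_eval b q.
Proof. by rewrite /fps_eval rmorphM hornerM. Qed.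

Lemma fps_eval_coef b p N n : b 0%N = 0 -> (n <= N)%N ->
  fps_eval b p n = \sum_(k < N.+1) p`_k * (b ^+ k) n.
Proof.
move=> b0 le_nN; pose M := maxn (size p) N.+1.
have -> : fps_eval b p = \sum_(k < M) fps_of_poly (p`_k)%:P * b ^+ k.
  rewrite /fps_eval (horner_coef_wide (n := M)); last first.
    by rewrite (leq_trans (size_poly _ _)) // leq_maxl.
  by apply: eq_bigr => k _; rewrite coef_map.
rewrite fps_sumE.
under eq_bigr do rewrite fps_constM.
rewrite -(big_mkord xpredT (fun k => p`_k * (b ^+ k) n)).
rewrite (big_cat_nat (n := N.+1)) ?leq_maxr //= big_mkord [X in _ + X]big1_seq ?addr0 //.
move=> k; rewrite mem_index_iota => /andP[_ /andP[lt_Nk _]].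
by rewrite fps_expr_lt ?mulr0 // (leq_ltn_trans le_nN).
Qed.

(** The coefficient of order n of a composite only sees the first n + 1
    coefficients of a, so that it can be computed with a polynomial in place of a.
    The product and chain rules are reduced in this way to polynomials. *)
Lemma fps_compE a b p n : b 0%N = 0 -> (forall k, (k <= n)%N -> p`_k = a k) ->
  fps_comp a b n = fps_eval b p n.
Proof.
move=> b0 e; rewrite (fps_eval_coef _ b0 (leqnn n)).
by apply: eq_bigr => k _; rewrite e // -ltnS.
Qed.

Lemma fps_truncE N a k : (k <= N)%N -> (fps_trunc N a)`_k = a k.
Proof. by move=> le_kN; rewrite coef_poly ltnS le_kN. Qed.

Lemma fps_compD a c b : fps_comp (a + c) b = fps_comp a b + fps_comp c b.
Proof.
by apply/fpsP => n; rewrite /= -big_split; apply: eq_bigr => i _; rewrite mulrDl.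
Qed.

Lemma fps_compM a c b : b 0%N = 0 ->
  fps_comp (a * c) b = fps_comp a b * fps_comp c b.
Proof.
move=> b0; apply/fpsP => n.
rewrite (@fps_compE _ _ (fps_trunc n a * fps_trunc n c)) //; last first.
  by move=> k le_kn; rewrite -fps_mul_trunc.
rewrite fps_evalM !fpsME; apply: eq_bigr => i _.
have le_in : (i <= n)%N by rewrite -ltnS.
by congr (_ * _); symmetry; apply: fps_compE => // k le_k;
  rewrite fps_truncE // (leq_trans le_k) ?leq_subr.
Qed.

Lemma fps_comp_poly p b : b 0%N = 0 ->
  fps_comp (fps_of_poly p) b = fps_eval b p.
Proof. by move=> b0; apply/fpsP => n; apply: fps_compE. Qed.

Lemma fps_comp0E a b : fps_comp a b 0%N = a 0%N.
Proof. by rewrite /= big_ord1 mulr1. Qed.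

Lemma fps_compN a b : fps_comp (- a) b = - fps_comp a b.
Proof.
by apply/fpsP => n /=; rewrite -sumrN; apply: eq_bigr => i _; rewrite mulNr.
Qed.

Lemma fps_compB a c b : fps_comp (a - c) b = fps_comp a b - fps_comp c b.
Proof. by rewrite fps_compD fps_compN. Qed.

Lemma fps_compC (c : R) b : fps_comp (fps_of_poly c%:P) b = fps_of_poly c%:P.
Proof.
apply/fpsP => n; rewrite /= big_ord_recl big1 ?addr0 => [|i _].
  by rewrite !coefC /=; case: (n) => [|?]; rewrite ?mulr1 ?mulr0.
by rewrite coefC mul0r.
Qed.

Lemma fps_compX b : b 0%N = 0 -> fps_comp (fpsX R) b = b.
Proof.
move=> b0; rewrite -fps_of_polyX fps_comp_poly // /fps_eval map_polyX hornerX.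
by [].
Qed.

Lemma fps_comp1 b : fps_comp 1 b = 1.
Proof. by rewrite -(rmorph1 (@fps_of_poly R)) -(rmorph1 (@polyC R)) fps_compC. Qed.

Lemma fps_comp2 b : fps_comp 2 b = 2.
Proof. by rewrite (natrD _ 1 1) fps_compD fps_comp1. Qed.

Lemma fps_derivD a c : fps_deriv (a + c) = fps_deriv a + fps_deriv c.
Proof. exact: fps_deriv_additive. Qed.

Lemma fps_deriv0 : fps_deriv (0 : fps R) = 0.
Proof. by apply/fpsP => n /=; rewrite mul0rn. Qed.

Lemma fps_derivC (c : R) : fps_deriv (fps_of_poly c%:P) = 0.
Proof. by apply/fpsP => n /=; rewrite coefC mul0rn. Qed.

Lemma fps_deriv1 : fps_deriv (1 : fps R) = 0.
Proof. by apply/fpsP => n /=; rewrite mul0rn. Qed.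

Lemma fps_derivX : fps_deriv (fpsX R) = 1.
Proof. by apply/fpsP => -[|n] /=; rewrite ?mulr1n ?mul0rn. Qed.

Lemma fps_derivN a : fps_deriv (- a) = - fps_deriv a.
Proof. by apply/fpsP => n /=; rewrite mulNrn. Qed.

Lemma fps_eval_deriv b p :
  fps_deriv (fps_eval b p) = fps_eval b p^`() * fps_deriv b.
Proof.
elim/poly_ind: p => [|p c IH].
  by rewrite deriv0 /fps_eval rmorph0 horner0 fps_deriv0 mul0r.
rewrite derivD derivM derivX derivC addr0 mulr1 /fps_eval !rmorphD !rmorphM /=.
rewrite map_polyX map_polyC !hornerE fps_derivD fps_derivM [fps_deriv (_.[b])]IH.
by rewrite /= fps_derivC /fps_eval; ring.
Qed.

Lemma fps_deriv_comp a b : b 0%N = 0 ->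
  fps_deriv (fps_comp a b) = fps_comp (fps_deriv a) b * fps_deriv b.
Proof.
move=> b0; apply/fpsP => n.
have -> : fps_deriv (fps_comp a b) n = fps_deriv (fps_eval b (fps_trunc n.+1 a)) n.
  congr (_ *+ _); apply: fps_compE => // k; exact: fps_truncE.
rewrite fps_eval_deriv !fpsME; apply: eq_bigr => i _; congr (_ * _).
symmetry; apply: fps_compE => // k le_k.
by rewrite coef_deriv fps_truncE // ltnS (leq_trans le_k) // -ltnS.
Qed.
End Composition.

(** * Rational powers of power series with constant term 1 *)

Local Notation "c %:S" := (@fps_of_poly rat c%:P) (at level 2, format "c %:S").

Lemma natr1_neq0 n : n.+1%:R != 0 :> rat. Proof. by rewrite pnatr_eq0. Qed.

Lemma fact_neq0 n : n`!%:R != 0 :> rat.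
Proof. by rewrite pnatr_eq0 -lt0n fact_gt0. Qed.

(** As U(0) is not 0, the coefficient of order n of U y' = V y expresses y_(n+1)
    in terms of y_0, ..., y_n. *)
Lemma fps_ode1_uniq (U V y z : fps rat) : U 0%N != 0 ->
  U * fps_deriv y = V * y -> U * fps_deriv z = V * z -> y 0%N = z 0%N -> y = z.
Proof.
move=> U0 Ey Ez yz0.
suff w0 n : (y - z) n = 0.
  by apply/eqP; rewrite -subr_eq0; apply/eqP/fpsP => n; rewrite w0.
have Ew : U * fps_deriv (y - z) = V * (y - z).
  by rewrite fps_derivD fps_derivN !mulrBr Ey Ez.
elim/ltn_ind: n => -[|n] IH; first by rewrite fpsDE fpsNE yz0 subrr.
move/fpsP/(_ n): Ew; rewrite !fpsME [RHS]big1 => [|i _]; last first.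
  by rewrite IH ?mulr0 // ltnS leq_subr.
rewrite big_ord_recl big1 ?addr0 => [/= |i _]; last first.
  rewrite -[fps_deriv _ _]/((y - z) _ *+ _) IH ?mul0rn ?mulr0 //.
  by rewrite ltnS ltn_subrL lt0n (leq_trans _ (ltn_ord i)).
move/eqP; rewrite subn0 mulf_eq0 (negPf U0) /=.
by rewrite -mulr_natr mulf_eq0 (negPf (natr1_neq0 n)) orbF => /eqP.
Qed.

Lemma binomial_seriesS s n :
  binomial_series s n.+1 * n.+1%:R = binomial_series s n * (s - n%:R).
Proof.
rewrite /= big_ord_recr /= factS natrM.
have := natr1_neq0 n; have := fact_neq0 n; move: n.+1%:R n`!%:R => u v v0 u0.
by field; rewrite u0 v0.
Qed.

Lemma binomial_series_ode s :
  (1 + fpsX rat) * fps_deriv (binomial_series s) = s%:S * binomial_series s.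
Proof.
apply/fpsP => n; rewrite mulrDl mul1r fpsDE fpsXM fps_constM.
have derE m : fps_deriv (binomial_series s) m = binomial_series s m * (s - m%:R).
  by rewrite -binomial_seriesS mulr_natr.
case: n => [|n]; rewrite derE ?addr0 ?subr0; first by rewrite mulrC.
by rewrite -[fps_deriv _ n]/(_ *+ n.+1) -mulr_natr; ring.
Qed.

(** This is the power U^s; it is meaningful only when U has constant term 1. *)
Definition fps_pow (U : fps rat) (s : rat) : fps rat :=
  fps_comp (binomial_series s) (U - 1).

Section Pow.
Implicit Types (U V y : fps rat) (s t : rat).

Lemma sub1_0E U : U 0%N = 1 -> (U - 1) 0%N = 0.
Proof. by move=> U0; rewrite fpsDE fpsNE U0 fps1E subrr. Qed.

Lemma fps_pow0E U s : fps_pow U s 0%N = 1.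
Proof. by rewrite /fps_pow fps_comp0E /= big_ord0 fact0 divr1. Qed.

Lemma fps_pow_ode U s : U 0%N = 1 ->
  U * fps_deriv (fps_pow U s) = s%:S * fps_deriv U * fps_pow U s.
Proof.
move=> /sub1_0E U0; rewrite fps_deriv_comp // mulrA.
have {1}-> : U = fps_comp (1 + fpsX rat) (U - 1).
  by rewrite fps_compD fps_comp1 fps_compX // addrC subrK.
rewrite -fps_compM // binomial_series_ode fps_compM // fps_compC.
by rewrite fps_derivD fps_derivN fps_deriv1 subr0 mulrAC.
Qed.

(** Every law of exponents below is an instance: its two sides have constant
    term 1 and the same logarithmic derivative. *)
Lemma fps_pow_uniq U s y : U 0%N = 1 -> y 0%N = 1 ->
  U * fps_deriv y = s%:S * fps_deriv U * y -> y = fps_pow U s.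
Proof.
move=> U0 y0 Ey; apply: (fps_ode1_uniq _ Ey (fps_pow_ode s U0)).
  by rewrite U0 oner_eq0.
by rewrite y0 fps_pow0E.
Qed.

Lemma fps_powD U s t : U 0%N = 1 ->
  fps_pow U (s + t) = fps_pow U s * fps_pow U t.
Proof.
move=> U0; symmetry; apply: fps_pow_uniq => //.
  by rewrite fpsM0E !fps_pow0E mulr1.
rewrite fps_derivM mulrDr mulrA fps_pow_ode // mulrCA fps_pow_ode // !rmorphD /=.
by ring.
Qed.

Lemma fps_powM U V s : U 0%N = 1 -> V 0%N = 1 ->
  fps_pow (U * V) s = fps_pow U s * fps_pow V s.
Proof.
move=> U0 V0; symmetry; apply: fps_pow_uniq.
- by rewrite fpsM0E U0 V0 mulr1.
- by rewrite fpsM0E !fps_pow0E mulr1.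
transitivity (V * fps_pow V s * (U * fps_deriv (fps_pow U s))
              + U * fps_pow U s * (V * fps_deriv (fps_pow V s))).
  by rewrite fps_derivM; ring.
by rewrite !fps_pow_ode // fps_derivM; ring.
Qed.

Lemma fps_powr0 U : U 0%N = 1 -> fps_pow U 0 = 1.
Proof.
move=> U0; symmetry; apply: fps_pow_uniq; rewrite ?fps1E //.
by rewrite fps_deriv1 !rmorph0 mulr0 !mul0r.
Qed.

Lemma fps_powr1 U : U 0%N = 1 -> fps_pow U 1 = U.
Proof.
by move=> U0; symmetry; apply: fps_pow_uniq => //; rewrite !rmorph1 mul1r mulrC.
Qed.

Lemma fps_pow_comp U s (b : fps rat) : U 0%N = 1 -> b 0%N = 0 ->
  fps_comp (fps_pow U s) b = fps_pow (fps_comp U b) s.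
Proof.
move=> U0 b0; apply: fps_pow_uniq; [by rewrite fps_comp0E | by rewrite fps_comp0E fps_pow0E |].
rewrite (fps_deriv_comp U b0) (fps_deriv_comp (fps_pow U s) b0) mulrA -fps_compM //.
rewrite fps_pow_ode // !fps_compM //.
by rewrite fps_compC; ring.
Qed.
End Pow.

(** * The hypergeometric series *)

Section Hyp.
Variables a b c : rat.
Hypothesis c_gt0 : 0 < c.
Let F := hyp2F1 a b c.

Lemma pochhammerS x n : pochhammer x n.+1 = pochhammer x n * (x + n%:R).
Proof. by rewrite /pochhammer big_ord_recr. Qed.

Lemma pochhammer_gt0 n : 0 < pochhammer c n.
Proof.
apply: prodr_gt0 => i _; exact: ltr_wpDr (ler0n _ _) c_gt0.
Qed.

Lemma hyp2F1S n :
  (c + n%:R) * (F n.+1 * n.+1%:R) = (a + n%:R) * (b + n%:R) * F n.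
Proof.
have p0 : pochhammer c n != 0 by rewrite gt_eqF ?pochhammer_gt0.
have c0 : c + n%:R != 0 by rewrite gt_eqF // ltr_wpDr.
rewrite /= !pochhammerS factS natrM.
have := natr1_neq0 n; have := fact_neq0 n; move: n.+1%:R n`!%:R => u v v0 u0.
by field; rewrite u0 v0 p0 c0.
Qed.

(** The coefficient of order n of the Gauss equation is the recurrence hyp2F1S. *)
Lemma hyp2F1_ode :
  fpsX rat * (1 - fpsX rat) * fps_deriv (fps_deriv F)
  + (c%:S - (a + b + 1)%:S * fpsX rat) * fps_deriv F - (a * b)%:S * F = 0.
Proof.
suff : fpsX rat * fps_deriv (fps_deriv F) + c%:S * fps_deriv F
  = fpsX rat * (fpsX rat * fps_deriv (fps_deriv F))
    + (a + b + 1)%:S * (fpsX rat * fps_deriv F) + (a * b)%:S * F.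
  by move/eqP; rewrite -subr_eq0 => /eqP <-; ring.
(* Collected by degree: the operator X y'' + c y' shifts the coefficients by 1,
   the other side acts diagonally, as (n + a) (n + b). *)
apply/fpsP => n; rewrite !fpsDE !fps_constM !fpsXM.
case: n => [|n].
  rewrite mulr0 !add0r; have := hyp2F1S 0.
  by rewrite !addr0 mulr1 => <-.
have e1 := hyp2F1S n.+1.
have derE m : fps_deriv F m = F m.+1 * m.+1%:R by rewrite mulr_natr.
have derE2 m : fps_deriv (fps_deriv F) m = F m.+2 * m.+2%:R * m.+1%:R.
  by rewrite -derE mulr_natr.
have eS : n.+1%:R = n%:R + 1 :> rat by rewrite natr1.
apply: etrans (_ : (c + n.+1%:R) * (F n.+2 * n.+2%:R) = _).
  by rewrite derE2 derE; ring.
rewrite e1 fpsXM derE; case: n eS {e1} => [|n] eS; last rewrite derE2.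
  by rewrite eS; ring.
have eS' : n.+1%:R = n%:R + 1 :> rat by rewrite natr1.
by rewrite eS eS'; ring.
Qed.
End Hyp.

(** * Differential modules and their solutions *)

Section LinEval.
Variables (n : nat) (C : 'M[Qx]_n) (h : 'cV[Laurent]_n).
Implicit Types v w : 'rV[Qx]_n.

Lemma lin_evalE v : lin_eval h v = \sum_j iota (v 0 j) * h j 0.
Proof. by rewrite /lin_eval mxE; apply: eq_bigr => j _; rewrite mxE. Qed.

Lemma lin_evalD v w : lin_eval h (v + w) = lin_eval h v + lin_eval h w.
Proof. by rewrite /lin_eval map_mxD mulmxDl mxE. Qed.

Lemma lin_evalZ c v : lin_eval h (c *: v) = iota c * lin_eval h v.
Proof. by rewrite /lin_eval map_mxZ -scalemxAl mxE. Qed.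

Lemma lin_eval0 : lin_eval h 0 = 0.
Proof. by rewrite /lin_eval map_mx0 mul0mx mxE. Qed.

Lemma lin_eval_delta i : lin_eval h (delta_mx 0 i) = h i 0.
Proof.
rewrite lin_evalE (bigD1 i) //= big1 ?addr0 => [|j ne_ji].
  by rewrite mxE !eqxx rmorph1 mul1r.
by rewrite mxE (negPf ne_ji) rmorph0 mul0r.
Qed.

Lemma derL_sum I (s : seq I) (F : I -> Laurent) :
  derL (\sum_(i <- s) F i) = \sum_(i <- s) derL (F i).
Proof.
apply: (big_morph derL derLD).
by apply: (addIr (derL 0)); rewrite -derLD !add0r.
Qed.

(** By the Leibniz rule, horizontality need only be tested on the basis. *)
Lemma horizontalP :
  (forall i, derL (h i 0) = \sum_j iota (C i j) * h j 0) -> horizontal C h.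
Proof.
move=> hC v; rewrite lin_evalD !lin_evalE derL_sum.
under eq_bigr do rewrite derLM derL_iota hC.
rewrite big_split /=; congr (_ + _); first by apply: eq_bigr => j _; rewrite mxE.
under eq_bigr do rewrite mulr_sumr.
rewrite exchange_big; apply: eq_bigr => j _ /=.
by rewrite mxE rmorph_sum mulr_suml; apply: eq_bigr => i _; rewrite rmorphM mulrA.
Qed.

Lemma horizontalE i : horizontal C h -> derL (h i 0) = \sum_j iota (C i j) * h j 0.
Proof.
move=> hC; rewrite -lin_eval_delta hC /conn -rowE.
have -> : map_mx derQ (delta_mx 0 i) = 0 :> 'rV_n.
  apply/rowP => j; rewrite [LHS]mxE [RHS]mxE [delta_mx _ _ _ _]mxE.
  case: (_ && _); [exact: (derivation1 derQM) | exact: (derivation0 derQD)].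
by rewrite add0r lin_evalE; apply: eq_bigr => j _; rewrite mxE.
Qed.

Lemma horizontal_iter v : horizontal C h -> forall i,
  iter i derL (lin_eval h v) = lin_eval h (iter i (conn C) v).
Proof. by move=> hC; elim=> //= i ->; rewrite hC. Qed.

Lemma diffop_app_wide (L : {poly Qx}) u m : (size L <= m)%N ->
  diffop_app L u = \sum_(i < m) iota L`_i * iter i derL u.
Proof.
move=> le_m; rewrite /diffop_app -!(big_mkord xpredT (fun i => iota L`_i * iter i derL u)).
rewrite [RHS](big_cat_nat (n := size L)) //= [X in _ + X]big1_seq ?addr0 // => i.
by rewrite mem_index_iota => /andP[_ /andP[le_i _]]; rewrite nth_default // rmorph0 mul0r.
Qed.

(** The n + 1 vectors v, \partial v, ..., \partial^n v of a module of rank n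
    are linearly dependent; the operator lists the coefficients of a relation. *)
Lemma horizontal_annihilated v :
  horizontal C h -> annihilated_order_le n (lin_eval h v).
Proof.
move=> hC; pose M : 'M[Qx]_(n.+1, n) := \matrix_i iter i (conn C) v.
have : ~~ row_free M by rewrite /row_free neq_ltn ltnS rank_leq_col.
rewrite -kermx_eq0 => /rowV0Pn[k /sub_kermxP kM k0].
exists (rVpoly k); split; last 1 first.
- rewrite (diffop_app_wide _ (size_poly _ _)).
  under eq_bigr do rewrite coef_rVpoly_ord horizontal_iter // -lin_evalZ.
  rewrite -(big_morph _ lin_evalD lin_eval0) -[RHS]lin_eval0; congr lin_eval.
  by rewrite -[RHS]kM mulmx_sum_row; apply: eq_bigr => i _; rewrite rowK.
- by apply: contra k0 => /eqP e; rewrite -(rVpolyK k) e linear0.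
- exact: size_poly.
Qed.
End LinEval.

Lemma sum_ord2 (V : zmodType) (F : 'I_2 -> V) : \sum_i F i = F 0 + F 1.
Proof. by rewrite big_ord_recl big_ord1; congr (_ + F _); apply: val_inj. Qed.

Lemma ord2P (P : 'I_2 -> Prop) : P 0 -> P 1 -> forall i, P i.
Proof.
move=> P0 P1 [[|[|//]] lt_i]; [move: P0 | move: P1]; congr P; exact: val_inj.
Qed.

Lemma lin_eval2 (h : 'cV[Laurent]_2) v :
  lin_eval h v = iota (v 0 0) * h 0 0 + iota (v 0 1) * h 1 0.
Proof. by rewrite lin_evalE sum_ord2. Qed.

(** In rank 2, e_0 generates as soon as \partial e_0 is a nonzero multiple of
    e_1. *)
Lemma diffmod_cyclic (C : 'M[Qx]_2) h : horizontal C h -> C 0 0 = 0 -> C 0 1 != 0 ->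
  forall y, diffmod (h 0 0) y <-> exists v, y = lin_eval h v.
Proof.
move=> hC C00 C01 y; split=> [[L ->] | [v ->]].
  exists (\sum_(i < size L) L`_i *: iter i (conn C) (delta_mx 0 0)).
  rewrite (big_morph _ (lin_evalD h) (lin_eval0 h)); apply: eq_bigr => i _.
  by rewrite lin_evalZ -horizontal_iter // lin_eval_delta.
have d0 : derL (h 0 0) = iota (C 0 1) * h 1 0.
  by rewrite (horizontalE _ hC) sum_ord2 C00 rmorph0 mul0r add0r.
exists ((v 0 0)%:P + (v 0 1 / C 0 1) *: 'X).
rewrite (@diffop_app_wide _ _ 2); last first.
  rewrite (leq_trans (size_polyD _ _)) // geq_max (leq_trans (size_polyC_leq1 _)) //.
  by rewrite (leq_trans (size_scale_leq _ _)) // size_polyX.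
rewrite big_ord_recl big_ord1 /= !coefD !coefZ !coefC !coefX /= mulr0 mulr1 addr0 add0r.
rewrite d0 mulrA -rmorphM divfK //; exact: lin_eval2.
Qed.

Lemma map_mx_sym2 (f : Qx -> Qx) C : {morph f : u v / u + v} -> f 0 = 0 ->
  map_mx f (sym2 C) = sym2 (map_mx f C).
Proof.
move=> fD f0; apply/matrixP => i j; rewrite !mxE.
by case: i => [[|[|[|//]]] ?]; case: j => [[|[|[|//]]] ?]; rewrite [nth [::] _ _]/= /=;
  rewrite ?f0 // ?mulr2n ?mulrDl ?mul1r ?fD.
Qed.

Lemma sym2Z c C : sym2 (c *: C) = c *: sym2 C.
Proof.
apply/matrixP => i j; rewrite !mxE.
by case: i => [[|[|[|//]]] ?]; case: j => [[|[|[|//]]] ?]; rewrite [nth [::] _ _]/= /=;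
  rewrite ?mulr0 // ?mulrDr // mulrCA.
Qed.

(** * Substitution in rational functions *)

HB.instance Definition _ := GRing.RMorphism.copy ratC
  (@FracField.tofrac {poly rat} \o @polyC rat).

(** Under this condition substituting g does not depend on the representative
    that ratcomp chooses, and it is a field morphism. *)
Definition transcendental (g : Qx) :=
  forall p : {poly rat}, p != 0 -> (map_poly ratC p).[g] != 0.

Section Ratcomp.
Variable g : Qx.
Hypothesis g_tr : transcendental g.

Lemma ratcompE n m : m != 0 ->
  ratcomp (n%:F / m%:F) g = (map_poly ratC n).[g] / (map_poly ratC m).[g].
Proof.
move=> m0; rewrite /ratcomp; apply/eqP.
rewrite eqr_div ?g_tr ?denom_ratioP // -!hornerM -!rmorphM /=.
by rewrite (frac_repr n m0).
Qed.

Lemma ratcomp_poly p : ratcomp p%:F g = (map_poly ratC p).[g].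
Proof.
rewrite -[p%:F]divr1 -(rmorph1 (@FracField.tofrac _)) ratcompE ?oner_eq0 //.
by rewrite rmorph1 hornerC divr1.
Qed.

Lemma ratcompX : ratcomp ratX g = g.
Proof. by rewrite ratcomp_poly map_polyX hornerX. Qed.

Lemma ratcompC c : ratcomp (ratC c) g = ratC c.
Proof. by rewrite ratcomp_poly map_polyC hornerC. Qed.

Lemma ratcompD u v : ratcomp (u + v) g = ratcomp u g + ratcomp v g.
Proof.
elim/frac_ind: u => n m m0; elim/frac_ind: v => p q q0.
rewrite frac_addE // !ratcompE ?mulf_neq0 // addf_div ?g_tr //.
by rewrite -!hornerM -hornerD -!rmorphM -rmorphD.
Qed.

Lemma ratcompM u v : ratcomp (u * v) g = ratcomp u g * ratcomp v g.
Proof.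
elim/frac_ind: u => n m m0; elim/frac_ind: v => p q q0.
by rewrite frac_mulE // !ratcompE ?mulf_neq0 // mulf_div -!hornerM -!rmorphM.
Qed.

Lemma ratcomp1 : ratcomp 1 g = 1.
Proof. by rewrite -(rmorph1 ratC) ratcompC. Qed.

Lemma ratcomp0 : ratcomp 0 g = 0.
Proof. by rewrite -(rmorph0 ratC) ratcompC. Qed.

Lemma ratcompN u : ratcomp (- u) g = - ratcomp u g.
Proof. by apply: (addIr (ratcomp u g)); rewrite -ratcompD !addNr ratcomp0. Qed.

Lemma ratcompV u : ratcomp u^-1 g = (ratcomp u g)^-1.
Proof.
have [-> | u0] := eqVneq u 0; first by rewrite invr0 ratcomp0 invr0.
have e : ratcomp u^-1 g * ratcomp u g = 1 by rewrite -ratcompM mulVf // ratcomp1.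
have r0 : ratcomp u g != 0.
  by apply/eqP => r0; move/eqP: e; rewrite r0 mulr0 eq_sym oner_eq0.
by apply: (mulIf r0); rewrite e mulVf.
Qed.

Lemma pullback_sym2 C : pullback g (sym2 C) = sym2 (pullback g C).
Proof.
rewrite /pullback sym2Z (map_mx_sym2 (f := ratcomp ^~ g)) //.
  exact: ratcompD.
exact: ratcomp0.
Qed.
End Ratcomp.

(** * Symmetric squares *)

Lemma lin_eval_sym2 (h : 'cV[Laurent]_2) v : lin_eval (sym2_vec h) v
  = iota (v 0 0) * h 0 0 ^+ 2 + iota (v 0 1) * (h 0 0 * h 1 0)
    + iota (v 0 2%:R) * h 1 0 ^+ 2.
Proof.
rewrite lin_evalE !big_ord_recl big_ord0 addr0 addrA !mxE /=.
by congr (_ + iota (v 0 _) * _ + iota (v 0 _) * _); apply: val_inj.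
Qed.

(** Leibniz rule on the products h_i h_j, which is how sym2 is defined. *)
Lemma sym2_horizontal C h : horizontal C h -> horizontal (sym2 C) (sym2_vec h).
Proof.
move=> hC; have hE i : derL (h i 0) = iota (C i 0) * h 0 0 + iota (C i 1) * h 1 0.
  by rewrite (horizontalE _ hC) sum_ord2.
apply: horizontalP => i; rewrite !big_ord_recl big_ord0 addr0.
rewrite !mxE; case: i => [[|[|[|//]]] ?] /=.
- by rewrite expr2 derLM !hE rmorph0 !rmorphM !rmorphMn rmorph1; ring.
- by rewrite derLM !hE rmorphD; ring.
- by rewrite expr2 derLM !hE rmorph0 !rmorphM !rmorphMn rmorph1; ring.
Qed.

Lemma sym2_image_lin_eval (M : Laurent -> Prop) (h : 'cV[Laurent]_2) :
  (forall y, M y <-> exists v, y = lin_eval h v) ->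
  forall y, sym2_image M y <-> exists v, y = lin_eval (sym2_vec h) v.
Proof.
move=> hM y; split=> [[s sM ->] | [v ->]].
  elim: s sM => [|[p q] s IH] sM; first by exists 0; rewrite big_nil lin_eval0.
  have [|w ew] := IH; first by move=> r rs; apply: sM; rewrite inE rs orbT.
  have [/= /hM[v ->] /hM[v' ->]] := sM _ (mem_head _ _).
  pose z := mx_of_rows 3
    [:: [:: v 0 0 * v' 0 0; v 0 0 * v' 0 1 + v 0 1 * v' 0 0; v 0 1 * v' 0 1]].
  exists (row 0 z + w); rewrite big_cons ew lin_evalD; congr (_ + _).
  rewrite lin_eval_sym2 !lin_eval2 !mxE /= rmorphD !rmorphM; ring.
exists [:: (iota (v 0 0) * h 0 0, h 0 0); (iota (v 0 1) * h 0 0, h 1 0);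
           (iota (v 0 2%:R) * h 1 0, h 1 0)].
  have Mh i : M (h i 0) by apply/hM; exists (delta_mx 0 i); rewrite lin_eval_delta.
  have MZh c i : M (iota c * h i 0).
    by apply/hM; exists (c *: delta_mx 0 i); rewrite lin_evalZ lin_eval_delta.
  by move=> p; rewrite !inE => /or3P[]/eqP->; split; rewrite /= ?MZh ?Mh.
rewrite !big_cons big_nil addr0 lin_eval_sym2 /=; ring.
Qed.

(** * Pullback of the Gauss module *)

Lemma iota_ratC c : iota (ratC c) = c%:S%:F.
Proof. exact: iota_poly. Qed.

(** The Gauss equation solved for its leading term and multiplied by d = g':
    the second row of the pulled back system. *)
Lemma gauss_equation_solved (K : fieldType) (x A C D y0 y1 y2 d : K) :
  x != 0 -> 1 - x != 0 -> x * (1 - x) * y2 + (C - D * x) * y1 - A * y0 = 0 ->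
  y2 * d = d * (A / (x * (1 - x))) * y0 + d * (- (C - D * x) / (x * (1 - x))) * y1.
Proof.
move=> x0 x1 e; apply: (mulIf (mulf_neq0 x0 x1)); apply/eqP; rewrite -subr_eq0.
apply/eqP; transitivity (d * 0); last exact: mulr0.
by rewrite -e; field; rewrite x0 x1.
Qed.

Section Pullback.
Variables (g : Qx) (phi : fps rat).
Hypotheses (g_phi : iota g = phi%:F) (phi0 : phi 0%N = 0) (phi_neq0 : phi != 0).

Lemma iota_horner p : iota (map_poly ratC p).[g] = (fps_eval phi p)%:F.
Proof.
rewrite -(horner_map iota) /= g_phi /fps_eval -(horner_map (@FracField.tofrac _)) /=.
rewrite -!map_poly_comp; congr _.[_].
by apply: eq_map_poly => c; apply: iota_ratC.
Qed.

(** A nonzero p is q X^m with q(0) != 0, and the value at phi of such a q has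
    constant term q(0), since phi has none. *)
Lemma pullback_transcendental : transcendental g.
Proof.
move=> p p0; rewrite -(fmorph_eq0 iota) /= iota_horner tofrac_eq0.
have [m [q]] := multiplicity_XsubC p 0; rewrite p0 subr0 /= => q0 ->.
rewrite fps_evalM mulf_neq0 //.
  apply: contra q0 => /eqP/fpsP/(_ 0%N); rewrite (fps_eval_coef _ phi0 (leqnn 0)).
  by rewrite big_ord1 /= mulr1 rootE horner_coef0 => ->.
by rewrite /fps_eval rmorphXn /= map_polyX hornerXn expf_neq0.
Qed.

Lemma iota_derQ_pullback : iota (derQ g) = (fps_deriv phi)%:F.
Proof. by rewrite -derL_iota g_phi derL_fps. Qed.

Lemma derQ_pullback_neq0 : derQ g != 0.
Proof.
rewrite -(fmorph_eq0 iota) /= iota_derQ_pullback tofrac_eq0.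
apply: contra phi_neq0 => /eqP/fpsP d0; apply/eqP/fpsP => -[//|n].
by have /eqP := d0 n; rewrite /= -mulr_natr mulf_eq0 pnatr_eq0 orbF => /eqP.
Qed.

Lemma pullback_neq01 : g != 0 /\ 1 - g != 0.
Proof.
split; first by rewrite -(fmorph_eq0 iota) /= g_phi tofrac_eq0.
rewrite -(fmorph_eq0 iota) rmorphB rmorph1 /= g_phi -tofrac1 -tofracB tofrac_eq0.
apply/eqP => /fpsP/(_ 0%N)/eqP.
by rewrite fpsDE fpsNE fps1E phi0 subr0 oner_eq0.
Qed.

Variables a b c : rat.
Hypothesis c_gt0 : 0 < c.
Let F := hyp2F1 a b c.
Let f := fps_comp F phi.

(** The solution (F, F') of the Gauss system, composed with phi: here F' is the
    derivative with respect to z, so that the derivative of f is g' times the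
    second entry. *)
Definition gauss_solution : 'cV[Laurent]_2 :=
  \col_i nth 0 [:: f%:F; (fps_comp (fps_deriv F) phi)%:F] i.

Lemma pullback_gaussE :
  [/\ pullback g (gauss a b c) 0 0 = 0,
      pullback g (gauss a b c) 0 1 = derQ g,
      pullback g (gauss a b c) 1 0 = derQ g * (ratC (a * b) / (g * (1 - g))) &
      pullback g (gauss a b c) 1 1
        = derQ g * (- (ratC c - ratC (a + b + 1) * g) / (g * (1 - g)))].
Proof.
have g_tr := pullback_transcendental.
have rX := ratcompX g_tr; have rC := ratcompC g_tr; have rD := ratcompD g_tr.
have rM := ratcompM g_tr; have rV := ratcompV g_tr; have rN := ratcompN g_tr.
have r1 := ratcomp1 g_tr; have r0 := ratcomp0 g_tr.
by split; rewrite !mxE [nth [::] _ _]/= [nth 0 _ _]/=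
  ?(r0, r1, mulr0, mulr1) // ?(rM, rV, rN, rC, rD, r1, rX).
Qed.

Lemma gauss_solution_horizontal :
  horizontal (pullback g (gauss a b c)) gauss_solution.
Proof.
have [C00 C01 C10 C11] := pullback_gaussE.
apply: horizontalP; apply: ord2P; rewrite sum_ord2.
  rewrite C00 C01 rmorph0 mul0r add0r iota_derQ_pullback !mxE /=.
  by rewrite derL_fps fps_deriv_comp // mulrC rmorphM.
rewrite C10 C11 !mxE /= derL_fps fps_deriv_comp //.
have [g0 g1] := pullback_neq01.
have Ig0 : phi%:F != 0 by rewrite tofrac_eq0.
have Ig1 : 1 - phi%:F != 0.
  by rewrite -g_phi -(rmorph1 iota) -rmorphB fmorph_eq0.
have I01 : iota (g * (1 - g)) = phi%:F * (1 - phi%:F).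
  by rewrite rmorphM rmorphB rmorph1 /= g_phi.
rewrite !(rmorphM iota (derQ g)) /= iota_derQ_pullback !fmorph_div /= iota_ratC I01.
rewrite (rmorphN iota) (rmorphB iota) (rmorphM iota) /= !iota_ratC g_phi.
rewrite tofracM; apply: (@gauss_equation_solved Laurent phi%:F _ _ _ _ _ _ _ Ig0 Ig1).
have := congr1 (fun u => (fps_comp u phi)%:F) (hyp2F1_ode a b c_gt0).
rewrite /= fps_compB fps_compD !fps_compM // !fps_compB fps_compM // !fps_compC.
rewrite fps_compX // fps_comp1 -(rmorph0 (@fps_of_poly rat)) -(rmorph0 (@polyC rat)).
by rewrite fps_compC !rmorph0 -/F -/f !(tofracM, tofracB, tofracD, tofrac1).
Qed.

Lemma sym2_pullback_of_gauss_hyp2F1 :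
  sym2_pullback_of_gauss a b c g f%:F (f ^+ 2)%:F.
Proof.
have [C00 C01 _ _] := pullback_gaussE.
have hor := gauss_solution_horizontal.
have h0 : gauss_solution 0 0 = f%:F by rewrite mxE.
have dm : forall y, diffmod f%:F y <-> exists v, y = lin_eval gauss_solution v.
  by rewrite -h0; apply: (diffmod_cyclic hor) => //; rewrite C01 derQ_pullback_neq0.
exists gauss_solution; split; first by split=> //; rewrite lin_eval_delta.
split; last exact: sym2_image_lin_eval.
  by rewrite (pullback_sym2 pullback_transcendental); apply: sym2_horizontal.
by rewrite lin_eval_delta mxE /= h0 rmorphXn.
Qed.

(** The symmetric square has rank 3. *)
Lemma hyp2F1_sqr_annihilated : annihilated_order_le 3 (f ^+ 2)%:F.
Proof.
have -> : (f ^+ 2)%:F = lin_eval (sym2_vec gauss_solution) (delta_mx 0 0).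
  by rewrite lin_eval_delta !mxE /= rmorphXn.
exact: horizontal_annihilated (sym2_horizontal gauss_solution_horizontal).
Qed.
End Pullback.

(** * Hypergeometric series in closed form *)

Lemma fpsXnE n k : (fpsX rat ^+ k) n = (n == k)%:R.
Proof.
elim: k n => [|k IH] n; first by rewrite fps1E.
by rewrite exprS fpsXM; case: n => // n; rewrite IH.
Qed.

Lemma fps_comp_NX (a : fps rat) n : fps_comp a (- fpsX rat) n = (-1) ^+ n * a n.
Proof.
have e k : ((- fpsX rat) ^+ k) n = (-1) ^+ k * (n == k)%:R.
  have -> : - fpsX rat = (-1)%:S * fpsX rat by rewrite !rmorphN !rmorph1 mulN1r.
  by rewrite exprMn -!rmorphXn fps_constM fpsXnE.
rewrite /=; under eq_bigr do rewrite e.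
rewrite big_ord_recr big1 /= => [|i _]; first by rewrite add0r eqxx mulr1 mulrC.
by rewrite gtn_eqF // !mulr0.
Qed.

Lemma fps_comp_X2 (a : fps rat) n :
  fps_comp a (fpsX rat ^+ 2) n = if odd n then 0 else a n./2.
Proof.
have e k : ((fpsX rat ^+ 2) ^+ k) n = (n == k.*2)%:R.
  by rewrite -exprM mul2n fpsXnE.
rewrite /=; under eq_bigr do rewrite e.
case: ifPn => [on | en].
  apply: big1 => i _; case: eqP => [en|_]; last by rewrite mulr0.
  by rewrite en odd_double in on.
have lt_n : (n./2 < n.+1)%N by rewrite ltnS leq_half_double -addnn leqW ?leq_addr.
rewrite (bigD1 (Ordinal lt_n)) //= even_halfK // eqxx mulr1 big1 ?addr0 // => i ne_i.
case: eqP => [en'|_]; last by rewrite mulr0.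
by case/eqP: ne_i; apply: val_inj; rewrite /= (congr1 half en') doubleK.
Qed.

(** This allows z to be replaced by s^2 in the identities to be proved. *)
Lemma fps_comp_X2_inj : injective (fun a : fps rat => fps_comp a (fpsX rat ^+ 2)).
Proof.
move=> a b /fpsP e; apply/fpsP => n; have := e n.*2.
by rewrite !fps_comp_X2 odd_double doubleK.
Qed.

Lemma fpsX20E : (fpsX rat ^+ 2) 0%N = 0.
Proof. by rewrite fpsXnE. Qed.

Lemma addX0E : (1 + fpsX rat) 0%N = 1.
Proof. by rewrite fpsDE fps1E addr0. Qed.

Lemma one_sub0E (a : fps rat) : a 0%N = 0 -> (1 - a) 0%N = 1.
Proof. by move=> a0; rewrite fpsDE fpsNE fps1E a0 subr0. Qed.

Lemma subX0E : (1 - fpsX rat) 0%N = 1.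
Proof. exact: one_sub0E. Qed.

Lemma hyp2F1_0E a b c : hyp2F1 a b c 0%N = 1.
Proof. by rewrite /= /pochhammer !big_ord0 fact0 !mulr1. Qed.

Lemma fps_derivE (a : fps rat) n : fps_deriv a n = a n.+1 * n.+1%:R.
Proof. by rewrite mulr_natr. Qed.

(** For b = c the recurrence loses the factor b + n and becomes
    (1 - z) F' = a F. *)
Lemma hyp2F1_cancel (a b : rat) : 0 < b ->
  hyp2F1 a b b = fps_pow (1 - fpsX rat) (- a).
Proof.
move=> b0; apply: (fps_pow_uniq subX0E).
  by rewrite hyp2F1_0E.
rewrite fps_derivD fps_derivN fps_deriv1 fps_derivX sub0r !rmorphN /= mulrN1 opprK.
apply/fpsP => n; rewrite mulrBl mul1r fpsDE fpsNE fpsXM fps_constM.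
have derE m : fps_deriv (hyp2F1 a b b) m = (a + m%:R) * hyp2F1 a b b m.
  have c0 : b + m%:R != 0 by rewrite gt_eqF // ltr_wpDr.
  apply: (mulfI c0); rewrite fps_derivE hyp2F1S //.
  by rewrite [RHS]mulrCA mulrA.
case: n => [|n]; rewrite derE; first by rewrite subr0 addr0.
by rewrite fps_derivE mulrDl [_ * n.+1%:R]mulrC addrK.
Qed.

Lemma fps_pow_addX s : fps_pow (1 + fpsX rat) s = binomial_series s.
Proof.
symmetry; apply: (fps_pow_uniq addX0E).
  by rewrite /= big_ord0 fact0 divr1.
by rewrite fps_derivD fps_deriv1 fps_derivX add0r mulr1 binomial_series_ode.
Qed.

Lemma fps_pow_subX s n :
  fps_pow (1 - fpsX rat) s n = (-1) ^+ n * binomial_series s n.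
Proof.
by rewrite /fps_pow (_ : 1 - fpsX rat - 1 = - fpsX rat) ?fps_comp_NX //; ring.
Qed.

Lemma subX2E : (1 + fpsX rat) * (1 - fpsX rat)
  = fps_comp (1 - fpsX rat) (fpsX rat ^+ 2).
Proof. by rewrite fps_compB fps_comp1 fps_compX ?fpsX20E //; ring. Qed.

(** The identity (1 + X) (1 - X) = 1 - X^2, raised to the power s. *)
Lemma fps_pow_mul_conj s : fps_pow (1 + fpsX rat) s * fps_pow (1 - fpsX rat) s
  = fps_comp (fps_pow (1 - fpsX rat) s) (fpsX rat ^+ 2).
Proof.
by rewrite -fps_powM ?addX0E ?subX0E // subX2E fps_pow_comp ?subX0E ?fpsX20E.
Qed.

Lemma addrn_mulS_neq0 (c : rat) n : 0 < c -> (c + n%:R) * n.+1%:R != 0.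
Proof.
move=> c_gt0; apply: mulf_neq0 (natr1_neq0 n).
exact: lt0r_neq0 (ltr_wpDr (ler0n _ n) c_gt0).
Qed.

(** With z = s^2, this is the even part of (1 + s)^(-1/2): two steps of the
    binomial recurrence bring the factors (2n + 1/2) (2n + 3/2), which are
    4 (n + 1/4) (n + 3/4), over (2n + 1) (2n + 2) = 4 (n + 1/2) (n + 1). *)
Lemma hyp2F1_even n :
  hyp2F1 (1 / 4) (3 / 4) (1 / 2) n = binomial_series (- (1 / 2)) n.*2.
Proof.
elim: n => [|n IH]; first by rewrite hyp2F1_0E /= big_ord0.
have c_gt0 : 0 < 1 / 2 :> rat by rewrite divr_gt0 ?ltr0n.
apply: (mulfI (addrn_mulS_neq0 n c_gt0)).
rewrite mulrAC -mulrA (hyp2F1S _ _ c_gt0) IH doubleS.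
have e1 := binomial_seriesS (- (1 / 2)) n.*2.+1.
have e2 := binomial_seriesS (- (1 / 2)) n.*2.
move: e1 e2; set B2 := binomial_series _ n.*2.+2; set B1 := binomial_series _ n.*2.+1.
set B0 := binomial_series _ _ => e1 e2.
have eS : n.+1%:R = n%:R + 1 :> rat by rewrite natr1.
have eD : n.*2%:R = 2 * n%:R :> rat by rewrite -mul2n natrM.
have eD1 : n.*2.+1%:R = 2 * n%:R + 1 :> rat by rewrite -natr1 eD.
have eD2 : n.*2.+2%:R = 2 * n%:R + 2 :> rat by rewrite -natr1 eD1 -addrA.
rewrite eS; rewrite eD1 eD2 in e1; rewrite eD1 eD in e2.
transitivity (4^-1 * (B1 * (2 * n%:R + 1) * (- (1 / 2) - (2 * n%:R + 1)))).
  by rewrite e2; field.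
transitivity (4^-1 * (B2 * (2 * n%:R + 2) * (2 * n%:R + 1))).
  by rewrite e1; ring.
by field.
Qed.

(** With z = s^2, this is twice the odd part of (1 + s)^(1/2), divided by s: the
    same factors now stand over (2n + 2) (2n + 3) = 4 (n + 1) (n + 3/2). *)
Lemma hyp2F1_odd n :
  hyp2F1 (1 / 4) (3 / 4) (3 / 2) n = 2 * binomial_series (1 / 2) n.*2.+1.
Proof.
elim: n => [|n IH].
  by rewrite hyp2F1_0E /= big_ord1.
have c_gt0 : 0 < 3 / 2 :> rat by rewrite divr_gt0 ?ltr0n.
apply: (mulfI (addrn_mulS_neq0 n c_gt0)).
rewrite mulrAC -mulrA (hyp2F1S _ _ c_gt0) IH doubleS.
have e1 := binomial_seriesS (1 / 2) n.*2.+2.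
have e2 := binomial_seriesS (1 / 2) n.*2.+1.
move: e1 e2; set B2 := binomial_series _ n.*2.+3; set B1 := binomial_series _ n.*2.+2.
set B0 := binomial_series _ _ => e1 e2.
have eS : n.+1%:R = n%:R + 1 :> rat by rewrite natr1.
have eD1 : n.*2.+1%:R = 2 * n%:R + 1 :> rat by rewrite -natr1 -mul2n natrM.
have eD2 : n.*2.+2%:R = 2 * n%:R + 2 :> rat by rewrite -natr1 eD1 -addrA.
have eD3 : n.*2.+3%:R = 2 * n%:R + 3 :> rat by rewrite -natr1 eD2 -addrA.
rewrite eS; rewrite eD3 eD2 in e1; rewrite eD1 eD2 in e2.
transitivity (2^-1 * (B1 * (2 * n%:R + 2) * (1 / 2 - (2 * n%:R + 2)))).
  by rewrite e2; field.
transitivity (2^-1 * (B2 * (2 * n%:R + 3) * (2 * n%:R + 2))).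
  by rewrite e1; ring.
by field.
Qed.

Lemma fps2_neq0 : 2 != 0 :> fps rat.
Proof. by apply/eqP => /fpsP/(_ 0%N)/eqP; rewrite fpsDE fps1E. Qed.

Lemma fps_pow_half_sqr (U : fps rat) : U 0%N = 1 -> fps_pow U (1 / 2) ^+ 2 = U.
Proof.
by move=> U0; rewrite expr2 -fps_powD // (_ : 1 / 2 + 1 / 2 = 1) ?fps_powr1.
Qed.

(** With r = sqrt (1 + s) and q = sqrt (1 - s), twice the series at s^2 is
    1 / r + 1 / q = (q + r) / (r q); now square. *)
Lemma hyp2F1_half_sqr : 2 * (1 - fpsX rat) * hyp2F1 (1 / 4) (3 / 4) (1 / 2) ^+ 2
  = 1 + fps_pow (1 - fpsX rat) (1 / 2).
Proof.
set F := hyp2F1 _ _ _; pose U : fps rat := 1 + fpsX rat; pose V : fps rat := 1 - fpsX rat.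
pose r := fps_pow U (1 / 2); pose q := fps_pow V (1 / 2).
pose sq a := fps_comp a (fpsX rat ^+ 2).
have r2 : r ^+ 2 = U := fps_pow_half_sqr addX0E.
have q2 : q ^+ 2 = V := fps_pow_half_sqr subX0E.
have inv_pow (W : fps rat) : W 0%N = 1 -> fps_pow W (- (1 / 2)) * fps_pow W (1 / 2) = 1.
  by move=> W0; rewrite -fps_powD // addNr fps_powr0.
have FE : 2 * sq F = fps_pow U (- (1 / 2)) + fps_pow V (- (1 / 2)).
  apply/fpsP => n; rewrite mulr_natl mulr2n !fpsDE fps_comp_X2 fps_pow_addX.
  rewrite fps_pow_subX -signr_odd; case: ifPn => on.
    by rewrite addr0 mulN1r subrr.
  by rewrite expr0 [1 * binomial_series _ _]mul1r /F hyp2F1_even even_halfK.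
have FE' : 2 * sq F * (r * q) = q + r.
  have pr := inv_pow U addX0E; have mq := inv_pow V subX0E.
  rewrite FE mulrDl mulrA pr [r * q]mulrC mulrA mq.
  by congr (_ + _); apply: mul1r.
apply: fps_comp_X2_inj; rewrite /= (fps_compM _ _ fpsX20E) (fps_compM _ _ fpsX20E).
rewrite expr2 (fps_compM _ _ fpsX20E) -/(sq F) fps_comp2 -subX2E fps_compD fps_comp1.
rewrite -fps_pow_mul_conj -/U -/V -/r -/q.
apply: (mulfI fps2_neq0); transitivity ((2 * sq F * (r * q)) ^+ 2).
  by rewrite -r2 -q2; ring.
transitivity (q ^+ 2 + r ^+ 2 + 2 * (r * q)); first by rewrite FE'; ring.
by rewrite r2 q2 /U /V; ring.
Qed.

(** With the same r and q, s times the series at s^2 is r - q. *)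
Lemma hyp2F1_three_half_sqr :
  fpsX rat * hyp2F1 (1 / 4) (3 / 4) (3 / 2) ^+ 2
  = 2 - 2 * fps_pow (1 - fpsX rat) (1 / 2).
Proof.
set F := hyp2F1 _ _ _; pose U : fps rat := 1 + fpsX rat; pose V : fps rat := 1 - fpsX rat.
pose r := fps_pow U (1 / 2); pose q := fps_pow V (1 / 2).
pose sq a := fps_comp a (fpsX rat ^+ 2).
have r2 : r ^+ 2 = U := fps_pow_half_sqr addX0E.
have q2 : q ^+ 2 = V := fps_pow_half_sqr subX0E.
have FE : fpsX rat * sq F = r - q.
  apply/fpsP => -[|n]; rewrite fpsXM fpsDE fpsNE.
    by rewrite !fps_pow0E subrr.
  rewrite fps_comp_X2 [r]fps_pow_addX fps_pow_subX -signr_odd oddS.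
  case: ifPn => on; first by rewrite expr0 [1 * binomial_series _ _]mul1r subrr.
  by rewrite mulN1r opprK /F hyp2F1_odd even_halfK // mulr_natl mulr2n.
apply: fps_comp_X2_inj; rewrite /= (fps_compM _ _ fpsX20E) (fps_compX fpsX20E).
rewrite expr2 (fps_compM _ _ fpsX20E) -/(sq F) fps_compB fps_comp2.
rewrite (fps_compM _ _ fpsX20E) fps_comp2 -fps_pow_mul_conj -/U -/V -/r -/q.
transitivity ((fpsX rat * sq F) ^+ 2); first by ring.
transitivity (r ^+ 2 + q ^+ 2 - 2 * (r * q)); first by rewrite FE; ring.
by rewrite r2 q2 /U /V; ring.
Qed.

(** * Squares in Q(x) *)

(** Infinite descent: if q(t) is not 0 then p(t)^2 = M(t) q(t)^2 is negative;
    otherwise t is a root of both p and q, and X - t can be cancelled. *)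
Lemma not_square_poly (M p q : {poly rat}) t : M.[t] < 0 -> q != 0 ->
  p ^+ 2 = M * q ^+ 2 -> False.
Proof.
move=> Mt; have [k] := ubnP (size q); elim: k => // k IH in p q *.
rewrite ltnS => szq q0 e.
have et : p.[t] ^+ 2 = M.[t] * q.[t] ^+ 2 by rewrite -!horner_exp e hornerM.
have [qt|qt] := eqVneq q.[t] 0; last first.
  have : p.[t] ^+ 2 < 0 by rewrite et nmulr_rlt0 // exprn_even_gt0.
  by rewrite ltNge sqr_ge0.
have /factor_theorem[p' ep] : root p t.
  by rewrite rootE -sqrf_eq0 et qt expr0n mulr0.
have /factor_theorem[q' eq] : root q t by rewrite rootE qt.
have X0 : 'X - t%:P != 0 by rewrite polyXsubC_eq0.
have q'0 : q' != 0 by apply: contra q0 => /eqP q'0; rewrite eq q'0 mul0r.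
apply: (IH p' q') => //.
  by apply: leq_trans szq; rewrite eq size_Mmonic ?monicXsubC // size_XsubC addn2.
apply: (mulIf (expf_neq0 2 X0)).
by rewrite -[RHS]mulrA -!exprMn -ep -eq.
Qed.

Lemma not_square (M : {poly rat}) t (r : Qx) : M.[t] < 0 -> r ^+ 2 != M%:F.
Proof.
move=> Mt; elim/frac_ind: r => p q q0; apply/eqP => e.
apply: (not_square_poly Mt q0 (p := p)).
apply/eqP; rewrite -tofrac_eq tofracXn tofracM tofracXn -e expr_div_n divfK //.
by rewrite expf_neq0 // tofrac_eq0.
Qed.

(** * Square roots of rational functions *)

(** The monic quadratic polynomial with roots a +- sqrt c. *)
Definition shifted_square (K : fieldType) (a c : K) : {poly K} :=
  ('X - a%:P) ^+ 2 - c%:P.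

Section ShiftedSquare.
Variables (K : fieldType) (a c : K).

Lemma shifted_squareE r : (shifted_square a c).[r] = (r - a) ^+ 2 - c.
Proof. by rewrite !hornerE. Qed.

Lemma size_shifted_square : size (shifted_square a c) = 3.
Proof.
have sz2 : size (('X - a%:P) ^+ 2) = 3 by rewrite size_exp_XsubC.
by rewrite size_polyDl ?sz2 // size_polyN (leq_ltn_trans (size_polyC_leq1 _)).
Qed.

Lemma shifted_square_irreducible (b w : K) : b != 0 -> c = b ^+ 2 * w ->
  (forall r : K, r ^+ 2 != w) -> irreducible_poly (shifted_square a c).
Proof.
move=> b0 ec nsq; apply: cubic_irreducible; rewrite ?size_shifted_square // => r.
rewrite rootE shifted_squareE subr_eq0 ec; apply: contra (nsq ((r - a) / b)) => /eqP e.
by rewrite expr_div_n e mulrC mulKf // expf_neq0.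
Qed.

Lemma map_shifted_square (L : fieldType) (f : {rmorphism K -> L}) :
  map_poly f (shifted_square a c) = shifted_square (f a) (f c).
Proof. by rewrite rmorphB rmorphXn rmorphB /= map_polyX !map_polyC. Qed.
End ShiftedSquare.

Section SquareRoot.
Variables (w : Qx) (U : fps rat).
Hypotheses (w_U : iota w = U%:F) (U0 : U 0%N = 1).

(** A power of a rational function has a rational logarithmic derivative. *)
Lemma fps_pow_derL s :
  derL (fps_pow U s)%:F = iota (ratC s * derQ w / w) * (fps_pow U s)%:F.
Proof.
have nzU : U%:F != 0.
  rewrite tofrac_eq0; apply/eqP => /fpsP/(_ 0%N)/eqP.
  by rewrite U0 oner_eq0.
have dw : iota (derQ w) = (fps_deriv U)%:F by rewrite -derL_iota w_U derL_fps.
rewrite derL_fps (rmorphM iota) (rmorphM iota) fmorphV /= iota_ratC dw w_U.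
apply: (mulfI nzU); rewrite -tofracM fps_pow_ode // 2!tofracM.
by rewrite [RHS]mulrA [U%:F * (_ / _)]mulrC divfK.
Qed.

Lemma fps_pow_annihilated s : annihilated_order 1 (fps_pow U s)%:F.
Proof.
exists ('X - (ratC s * derQ w / w)%:P); split.
- by rewrite polyXsubC_eq0.
- by rewrite size_XsubC.
rewrite /diffop_app size_XsubC big_ord_recl big_ord1 !coefB !coefX !coefC /=.
by rewrite sub0r subr0 rmorphN rmorph1 mul1r /= fps_pow_derL mulNr addNr.
Qed.

Variables (u : Laurent) (q al be : Qx).
Hypotheses (q_neq0 : q != 0) (be_neq0 : be != 0).
Hypothesis uE : iota q * u = iota al + iota be * (fps_pow U (1 / 2))%:F.

Lemma sqrt_combination : u = iota (al / q) + iota (be / q) * (fps_pow U (1 / 2))%:F.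
Proof.
have q0 : iota q != 0 by rewrite (fmorph_eq0 iota) q_neq0.
have qK a : iota q * iota (a / q) = iota a.
  by rewrite -(rmorphM iota); congr iota; rewrite mulrC (divfK q_neq0).
by apply: (mulfI q0); rewrite mulrDr (qK al) (mulrA (iota q) (iota _)) (qK be) uE.
Qed.

(** 1 and sqrt U are horizontal for a diagonal connection of rank 2. *)
Lemma sqrt_annihilated : annihilated_order_le 2 u.
Proof.
pose h : 'cV[Laurent]_2 := \col_i nth 0 [:: 1; (fps_pow U (1 / 2))%:F] i.
pose C : 'M[Qx]_2 := mx_of_rows 2 [:: [:: 0; 0]; [:: 0; ratC (1 / 2) * derQ w / w]].
pose v : 'rV[Qx]_2 := \row_i nth 0 [:: al / q; be / q] i.
have -> : u = lin_eval h v.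
  by rewrite lin_eval2 !mxE /= mulr1 sqrt_combination.
apply: (@horizontal_annihilated _ C); apply: horizontalP; apply: ord2P.
  rewrite sum_ord2 !mxE /= rmorph0 !mul0r addr0 -[1 in LHS](rmorph1 iota) derL_iota.
  by rewrite (derivation1 derQM) rmorph0.
by rewrite sum_ord2 !mxE /= rmorph0 mul0r add0r fps_pow_derL.
Qed.

Lemma sqrt_quadratic : (forall r : Qx, r ^+ 2 != w) -> quadratic_algebraic u.
Proof.
move=> w_nsq; have := sqrt_combination.
move: (al / q) (be / q) (mulf_neq0 be_neq0 (invr_neq0 q_neq0)) => A B B0 uAB.
exists (shifted_square A (B ^+ 2 * w)); split; last 1 first.
- rewrite (map_shifted_square _ _ iota) shifted_squareE uAB [iota A + _]addrC addrK.
  rewrite exprMn -tofracXn fps_pow_half_sqr // -w_U (rmorphM iota) (rmorphXn iota).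
  exact: subrr.
- exact: (shifted_square_irreducible _ B0 (erefl _) w_nsq).
- exact: size_shifted_square.
Qed.
End SquareRoot.

(** * The rows of the table *)

Lemma fps_nat0E n : (n%:R : fps rat) 0%N = n%:R.
Proof. by elim: n => // n IH; rewrite -natr1 -[RHS]natr1 fpsDE IH. Qed.

Lemma fpsX_muln0E n : (fpsX rat *+ n) 0%N = 0.
Proof. by rewrite -mulr_natl fpsM0E mulr0. Qed.

Lemma phi_denom_unit n m : 1 - n%:R * (fpsX rat *+ m) \is a GRing.unit.
Proof.
by rewrite fps_unitE fpsDE fpsNE fps1E fpsM0E fpsX_muln0E mulr0 subr0 unitr1.
Qed.

(** The same formula defines the pullback map in Q(x) and in Q[[x]]; morphisms
    carry both values into Q((x)). *)
Lemma row_phi_morph i (R S : comUnitRingType) (f : {rmorphism R -> S}) (x : R) :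
  1 - x \is a GRing.unit -> 1 - 4 * x \is a GRing.unit ->
  f (row_phi i x) = row_phi i (f x).
Proof.
move=> u1 u4; case: i; rewrite /= !rmorphM ?rmorphV ?unitrX //
  ?rmorphXn ?rmorphB ?rmorphM ?rmorph1 ?rmorph_nat //.
Qed.

Lemma iota_ratX_muln m : iota (ratX *+ m) = (fpsX rat *+ m)%:F.
Proof. by rewrite !rmorphMn /= iota_poly fps_of_polyX. Qed.

Lemma ratX_denom_neq0 n m : 1 - n%:R * (ratX *+ m) != 0.
Proof.
rewrite -(fmorph_eq0 iota) rmorphB rmorphM rmorph_nat rmorph1 /= iota_ratX_muln.
rewrite -(rmorph_nat (@FracField.tofrac _)) -(rmorph1 (@FracField.tofrac _)).
rewrite -rmorphM -rmorphB tofrac_eq0; apply/eqP => e.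
by have := phi_denom_unit n m; rewrite e unitr0.
Qed.

Lemma ratX_sub_neq0 m : 1 - ratX *+ m != 0.
Proof. by have := ratX_denom_neq0 1 m; rewrite mul1r. Qed.

Lemma phi_ratE i : iota (phi_rat i) = (phi_fps i)%:F.
Proof.
have u1 m : 1 - fpsX rat *+ m \is a GRing.unit.
  by have := phi_denom_unit 1 m; rewrite mul1r.
rewrite /phi_rat (row_phi_morph _ iota) ?unitfE ?ratX_denom_neq0 ?ratX_sub_neq0 //.
rewrite /= iota_ratX_muln -(row_phi_morph _ (@FracField.tofrac _)) //.
exact: phi_denom_unit.
Qed.

Lemma phi_fps_neq0 i : phi_fps i != 0.
Proof.
have X0 m : fpsX rat *+ m.+1 != 0.
  apply/eqP => /fpsP/(_ 1%N)/eqP.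
  by rewrite -mulr_natl mulrC fpsXM fps_nat0E pnatr_eq0.
have n0 n : n.+1%:R != 0 :> fps rat.
  by apply/eqP => /fpsP/(_ 0%N)/eqP; rewrite fps_nat0E pnatr_eq0.
have d0 n m : 1 - n%:R * (fpsX rat *+ m) != 0.
  by apply/eqP => e; have := phi_denom_unit n m; rewrite e unitr0.
have y0 : fpsX rat *+ row_lambda i != 0 by case: (i); apply: X0.
have y4 := d0 4 (row_lambda i); have := d0 1%N (row_lambda i); rewrite mul1r => y1.
rewrite /phi_fps; move: (fpsX rat *+ _) y0 y1 y4 => y y0 y1 y4.
by case: (i) => /=; rewrite !mulf_neq0 ?invr_eq0 ?expf_neq0 ?(n0 3) ?(n0 26).
Qed.

Lemma row_c_gt0 i : 0 < row_c i.
Proof. by case: i; rewrite /row_c /= ?divr_gt0 ?ltr0n ?ltr01. Qed.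

Lemma one_minus_phi_powE i s : one_minus_phi_pow i s = fps_pow (1 - phi_fps i) s.
Proof.
by rewrite /one_minus_phi_pow /fps_pow (_ : 1 - phi_fps i - 1 = - phi_fps i) //; ring.
Qed.

Lemma one_minus_phi_ratE i : iota (1 - phi_rat i) = (1 - phi_fps i)%:F.
Proof. by rewrite rmorphB rmorph1 /= phi_ratE rmorphB rmorph1. Qed.

Lemma row_f_cancel i : row_b i = row_c i ->
  row_f i = fps_pow (1 - phi_fps i) (- row_a i).
Proof.
have p0 := phi_fps0 i; move=> ebc.
rewrite /row_f ebc hyp2F1_cancel ?row_c_gt0 // fps_pow_comp ?subX0E //.
by rewrite fps_compB fps_comp1 fps_compX.
Qed.

(** Naturality lets the value at t of the polynomial M X be computed as M t. *)
Lemma not_square_expr (M : forall R : comNzRingType, R -> R) (t : rat) (r : Qx) :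
  (forall (R S : comNzRingType) (f : {rmorphism R -> S}) x, f (M R x) = M S (f x)) ->
  M rat t < 0 -> r ^+ 2 <> M Qx ratX.
Proof.
move=> M_morph Mt; rewrite -(M_morph _ _ (@FracField.tofrac _)).
apply/eqP/(@not_square _ t); rewrite -[_.[_]]/(horner_eval t _) M_morph.
by rewrite /= /horner_eval hornerX.
Qed.

Lemma row9_radicand (K : fieldType) (r x : K) : 1 - x != 0 ->
  r ^+ 2 = 1 - row_phi Row9 x -> (r * (1 - x)) ^+ 2 = (1 - x) ^+ 2 - 4 * x.
Proof. by move=> x1 e; rewrite exprMn e /=; field. Qed.

Lemma row11_radicand (K : fieldType) (r x : K) : 1 - 4 * x != 0 ->
  r ^+ 2 = 1 - row_phi Row11 x ->
  (r * (1 - 4 * x) ^+ 2) ^+ 2 = (1 - 4 * x) ^+ 4 - 27 * x * (1 - 4 * x).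
Proof. by move=> x1 e; rewrite exprMn e /=; field. Qed.

(** Up to the square of a denominator, 1 - phi is a polynomial that is negative
    at a rational point. *)
Lemma row_not_square i : i = Row9 \/ i = Row11 ->
  forall r : Qx, r ^+ 2 != 1 - phi_rat i.
Proof.
case=> -> r; apply/eqP; rewrite /phi_rat.
  move/(row9_radicand (ratX_sub_neq0 _)).
  pose M (R : comNzRingType) (x : R) := (1 - x *+ 1) ^+ 2 - 4 * (x *+ 1).
  apply: (@not_square_expr M 1) => [R S f x|].
    by rewrite /M !(rmorphB, rmorphM, rmorphXn, rmorphMn, rmorph1).
  by rewrite (_ : M _ 1 = - 4) ?oppr_lt0 ?ltr0n.
move/(row11_radicand (ratX_denom_neq0 4 _)).
pose M (R : comNzRingType) (x : R) :=
  (1 - 4 * (x *+ 4)) ^+ 4 - 27 * (x *+ 4) * (1 - 4 * (x *+ 4)).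
(* At x = 1/32 the rescaled variable is 4 x = 1/8, where phi = 27. *)
apply: (@not_square_expr M (1 / 32)) => [R S f x|].
  by rewrite /M !(rmorphB, rmorphM, rmorphXn, rmorphMn, rmorph1).
by rewrite (_ : M _ _ = - (13 / 8)) ?oppr_lt0 ?divr_gt0 ?ltr0n.
Qed.

Lemma row_A_comp i : row_A i
  = fps_comp (hyp2F1 (row_a i) (row_b i) (row_c i) ^+ 2) (phi_fps i).
Proof. by rewrite expr2 fps_compM ?phi_fps0. Qed.

Lemma fps_comp_pow_subX (phi : fps rat) s : phi 0%N = 0 ->
  fps_comp (fps_pow (1 - fpsX rat) s) phi = fps_pow (1 - phi) s.
Proof.
by move=> p0; rewrite fps_pow_comp ?subX0E // fps_compB fps_comp1 fps_compX.
Qed.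

Lemma row9_A : 2 * (1 - phi_fps Row9) * row_A Row9
  = 1 + fps_pow (1 - phi_fps Row9) (1 / 2).
Proof.
have p0 := phi_fps0 Row9; rewrite row_A_comp -fps_comp_pow_subX //.
have := congr1 (fun a => fps_comp a (phi_fps Row9)) hyp2F1_half_sqr.
rewrite /= (fps_compM (_ * _) _ p0) (fps_compM 2 _ p0) fps_comp2 fps_compB.
by rewrite fps_compD !fps_comp1 (fps_compX p0).
Qed.

Lemma row11_A : phi_fps Row11 * row_A Row11
  = 2 - 2 * fps_pow (1 - phi_fps Row11) (1 / 2).
Proof.
have p0 := phi_fps0 Row11; rewrite row_A_comp -fps_comp_pow_subX //.
have := congr1 (fun a => fps_comp a (phi_fps Row11)) hyp2F1_three_half_sqr.
by rewrite /= (fps_compM _ _ p0) (fps_compX p0) fps_compB (fps_compM 2 _ p0) fps_comp2.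
Qed.

Lemma row_A_sqrt i : i = Row9 \/ i = Row11 -> exists q al be : Qx,
  [/\ q != 0, be != 0 & iota q * (row_A i)%:F
      = iota al + iota be * (fps_pow (1 - phi_fps i) (1 / 2))%:F].
Proof.
have two0 : 2 != 0 :> Qx by rewrite -(rmorph_nat ratC) (fmorph_eq0 ratC).
have iota2 : iota 2 = 2%:F by rewrite !rmorph_nat.
have neq01 i := pullback_neq01 (phi_ratE i) (phi_fps0 i) (phi_fps_neq0 i).
case=> ->.
  exists (2 * (1 - phi_rat Row9)), 1, 1; split.
  - exact: (mulf_neq0 two0 (neq01 Row9).2).
  - exact: oner_neq0.
  have -> : iota (2 * (1 - phi_rat Row9)) = (2 * (1 - phi_fps Row9))%:F.
    by rewrite tofracM -iota2 -one_minus_phi_ratE -(rmorphM iota).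
  rewrite -tofracM row9_A tofracD tofrac1 rmorph1; congr (_ + _).
  exact/esym/mul1r.
exists (phi_rat Row11), 2, (- 2); split.
- exact: (neq01 Row11).1.
- by rewrite oppr_eq0 two0.
rewrite phi_ratE (rmorphN iota) /= iota2 -tofracM row11_A.
by rewrite tofracB tofracM mulNr.
Qed.

Theorem proposition5p2 :
  [/\ forall i : table_row,
        sym2_pullback_of_gauss (row_a i) (row_b i) (row_c i) (phi_rat i)
          (row_f i)%:F (row_A i)%:F,
      forall i : table_row, i = Row5 \/ i = Row13 ->
        [/\ annihilated_order 1 (row_A i)%:F,
            row_f i = one_minus_phi_pow i (- row_a i) &
            row_A i = one_minus_phi_pow i (- (2 * row_a i))],
      forall i : table_row, i = Row9 \/ i = Row11 ->
        annihilated_order_le 2 (row_A i)%:F /\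
        quadratic_algebraic (row_A i)%:F &
      forall i : table_row,
        i = Row2 \/ i = Row3 \/ i = Row4 \/ i = Row10 \/ i = Row12 \/
        i = Row14 \/ i = Row15 ->
        annihilated_order_le 3 (row_A i)%:F].
Proof.
split=> [i | i i5 | i i9 | i _].
- exact: (sym2_pullback_of_gauss_hyp2F1 (phi_ratE i) (phi_fps0 i) (phi_fps_neq0 i)
            (row_a i) (row_b i) (row_c_gt0 i)).
- have fE : row_f i = fps_pow (1 - phi_fps i) (- row_a i).
    by apply: row_f_cancel; case: i5 => ->.
  have U0 := one_sub0E (phi_fps0 i).
  have AE : row_A i = fps_pow (1 - phi_fps i) (- (2 * row_a i)).
    by rewrite /row_A fE expr2 -fps_powD //; congr fps_pow; ring.
  split; rewrite ?one_minus_phi_powE // AE.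
  exact: fps_pow_annihilated (one_minus_phi_ratE i) U0 _.
- have [q [al [be [q0 be0 uE]]]] := row_A_sqrt i9.
  have wU := one_minus_phi_ratE i; have U0 := one_sub0E (phi_fps0 i).
  split; first exact: (sqrt_annihilated wU U0 q0 uE).
  exact: (sqrt_quadratic wU U0 q0 be0 uE (row_not_square i9)).
- exact: (hyp2F1_sqr_annihilated (phi_ratE i) (phi_fps0 i) (phi_fps_neq0 i)
            (row_a i) (row_b i) (row_c_gt0 i)).
Qed.
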